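(* Let $k$ be a field of characteristic zero and $R=k[s,t,x,y,z]$, bigraded with $\deg s=\deg t=(1,0)$ and $\deg x=\deg y=\deg z=(0,1)$. Let $n\ge 2$, let $A_1,\dots,A_n\in R_{(1,0)}$ and $B_1,\dots,B_n\in R_{(0,1)}$ be nonzero, let $m\ge 0$ be an integer, and let $$Z=\mathbb V(A_1,B_1)+\cdots+\mathbb V(A_n,B_n)+m\cdot\mathbb V(B_1,B_2)\subseteq\mathbb P^1\times\mathbb P^2,$$ i.e. $I_Z=(A_1,B_1)\cap\cdots\cap(A_n,B_n)\cap(B_1,B_2)^m$. Assume: (1) $\mathbb V(A_{n-1})\neq\mathbb V(A_n)$; (2) $\mathbb V(B_i)\neq\mathbb V(B_j)$ for $i\neq j$; (3) $\mathbb V(B_1,\dots,B_n)=\mathbb V(B_1,B_2)$, i.e. every $B_i$ lies in the $k$-span of $B_1,B_2$. Then $Z$ is ACM (i.e. $R/I_Z$ is Cohen–Macaulay) if and only if $m\ge n-1$.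
   Context: $\mathbb V(A_i,B_i)$ is a (horizontal) line of $\mathbb P^1\times\mathbb P^2$ with ideal $(A_i,B_i)$, and $\mathbb V(B_1,B_2)$ is a (vertical) line with ideal $(B_1,B_2)$; $m\cdot\mathbb V(B_1,B_2)$ denotes the fat line with ideal $(B_1,B_2)^m$ (absent if $m=0$). *)

(* Defs.v *)
From HB Require Import structures.
From mathcomp Require Import all_boot all_order all_algebra.
From mathcomp Require Import mpoly.
Set Implicit Arguments. Unset Strict Implicit. Unset Printing Implicit Defensive.
Import GRing.Theory.
Local Open Scope ring_scope.

(* The ring R = k[s,t,x,y,z] is {mpoly k[5]}; variables 0,1 are s,t
   (degree (1,0)) and variables 2,3,4 are x,y,z (degree (0,1)). *)
Section Defs.
Variable k : fieldType.
Notation R := {mpoly k[5]}.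

Definition var (i : nat) : R := 'X_(inord i).

Definition in_R10 (p : R) : Prop :=
  exists a b : k, p = a *: var 0%N + b *: var 1%N.
Definition in_R01 (p : R) : Prop :=
  exists a b c : k, p = a *: var 2%N + b *: var 3%N + c *: var 4%N.

Definition ideal_gen (s : seq R) : R -> Prop :=
  fun p => exists c : seq R, size c = size s /\
                 p = \sum_(i < size s) c`_i * s`_i.
Definition ideal_sum (I J : R -> Prop) : R -> Prop :=
  fun p => exists a b, I a /\ J b /\ p = a + b.
Definition ideal_pow2 (f g : R) (m : nat) : R -> Prop :=
  ideal_gen [seq f ^+ i * g ^+ (m - i) | i <- iota 0 m.+1].

Definition is_ideal (P : R -> Prop) : Prop :=
  P 0 /\ (forall a b, P a -> P b -> P (a + b)) /\
  (forall r a, P a -> P (r * a)).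
Definition is_prime (P : R -> Prop) : Prop :=
  is_ideal P /\ ~ P 1 /\ (forall a b, P (a * b) -> P a \/ P b).

Definition prime_chain (I : R -> Prop) (d : nat) : Prop :=
  exists P : nat -> R -> Prop,
    (forall j, (j <= d)%N -> is_prime (P j) /\ (forall a, I a -> P j a)) /\
    (forall j, (j < d)%N -> (forall a, P j a -> P j.+1 a) /\
                           exists a, P j.+1 a /\ ~ P j a).
Definition krull_dim (I : R -> Prop) (d : nat) : Prop :=
  prime_chain I d /\ ~ prime_chain I d.+1.

Definition irrel (p : R) : Prop := meval (fun _ => 0) p = 0.

Definition regular_seq (I : R -> Prop) (f : seq R) : Prop :=
  (forall a, a \in f -> irrel a) /\
  ~ ideal_sum I (ideal_gen f) 1 /\
  (forall j, (j < size f)%N -> forall g,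
      ideal_sum I (ideal_gen (take j f)) (f`_j * g) ->
      ideal_sum I (ideal_gen (take j f)) g).

(* R/I is Cohen-Macaulay: depth_m(R/I) = dim R/I (depth <= dim always) *)
Definition cohen_macaulay (I : R -> Prop) : Prop :=
  exists d, krull_dim I d /\ exists f, size f = d /\ regular_seq I f.

(* zero locus (k-points of the affine cone with both factors nonzero) *)
Definition zero_locus (s : seq R) : ('I_5 -> k) -> Prop :=
  fun v => (v (inord 0) != 0 \/ v (inord 1) != 0) /\
           (v (inord 2) != 0 \/ v (inord 3) != 0 \/ v (inord 4) != 0) /\
           (forall p, p \in s -> meval v p = 0).

Definition IZ (n m : nat) (A B : nat -> R) : R -> Prop :=
  fun p => (forall i, (1 <= i <= n)%N -> ideal_gen [:: A i; B i] p) /\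
           ideal_pow2 (B 1%N) (B 2%N) m p.
End Defs.

(* Main.v *)
(** The forms [B_i] lie in the span of [B_1] and [B_2]; let [C] complete them to a
    basis of the forms of degree (0,1).

    If [m >= n-1], choose a form [E] in the span of [B_1], [B_2] and a scalar [mu]
    such that [E] is proportional to no [B_i] and the substitution [s -> E],
    [t -> mu E] kills no [A_i].  With [G_i] the product of the [B_j], [j <> i], and
    [F] the product of all [B_j], interpolation of binary forms shows that [I_Z] is
    generated by the [A_i G_i E^(m+1-n)] and [F (B_1,B_2)^(m-n)] (truncated
    subtraction).  The relations between these generators modulo [C], [s - E],
    [t - mu E] all lift, so these three elements form a regular sequence on [R/I_Z].

    If [m < n-1], let [u] be a combination of [A_{n-1}] and [A_n] proportional to no
    [A_i].  Then [C, u] is regular on [R/I_Z], and [w = A_{n-1} B_1 ... B_{n-2}]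
    is a nonzero socle element modulo [I_Z + (C, u)]; hence the depth is 2.

    The dimension is 3: primes over [I_Z] contain two independent linear forms, and
    chains of primes in [R] are bounded by counting monomials. *)
Require Import Defs.
From HB Require Import structures.
From mathcomp Require Import all_boot all_order all_algebra.
From mathcomp Require Import mpoly.
From mathcomp Require Import ring zify.
From Stdlib Require Import FunctionalExtensionality PropExtensionality.
Set Implicit Arguments. Unset Strict Implicit. Unset Printing Implicit Defensive.
Import GRing.Theory.
Local Open Scope ring_scope.

(** * Ideals *)

Section Ideals.
Variable k : fieldType.
Notation R := {mpoly k[5]}.
Implicit Types (I J P : R -> Prop) (s : seq R) (p q f g h : R).

Lemma idealD I p q : is_ideal I -> I p -> I q -> I (p + q).
Proof. by case=> _ [H _]; apply: H. Qed.

Lemma ideal_mull I p q : is_ideal I -> I q -> I (p * q).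
Proof. by case=> _ [_ H]; apply: H. Qed.

Lemma ideal_mulr I p q : is_ideal I -> I p -> I (p * q).
Proof. by move=> hI; rewrite mulrC; apply: ideal_mull. Qed.

Lemma idealN I p : is_ideal I -> I p -> I (- p).
Proof. by move=> hI hp; rewrite -mulN1r; apply: ideal_mull. Qed.

Lemma idealB I p q : is_ideal I -> I p -> I q -> I (p - q).
Proof. by move=> hI hp hq; apply: idealD => //; apply: idealN. Qed.

Lemma idealDr I p q : is_ideal I -> I p -> I (p + q) -> I q.
Proof. by move=> hI hp hpq; rewrite -[q](addKr p) addrC; apply: idealB. Qed.

Lemma ideal_bigsum I (T : Type) (r : seq T) (Q : pred T) (F : T -> R) :
  is_ideal I -> (forall i, Q i -> I (F i)) -> I (\sum_(i <- r | Q i) F i).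
Proof.
by move=> hI hF; elim/big_ind: _ => //; [case: hI | move=> *; apply: idealD].
Qed.

Lemma ideal_gen_ideal s : is_ideal (ideal_gen s).
Proof.
split; [|split].
- exists (nseq (size s) 0); rewrite size_nseq; split=> //.
  by rewrite big1 // => i _; rewrite nth_nseq if_same mul0r.
- move=> a b [c [hc ->]] [d [hd ->]].
  exists (mkseq (fun i => c`_i + d`_i) (size s)); rewrite size_mkseq.
  split=> //; rewrite -big_split; apply: eq_bigr => i _.
  by rewrite nth_mkseq // mulrDl.
- move=> r a [c [hc ->]]; exists (mkseq (fun i => r * c`_i) (size s)).
  rewrite size_mkseq; split=> //; rewrite mulr_sumr; apply: eq_bigr => i _.
  by rewrite nth_mkseq // mulrA.
Qed.
#[local] Hint Resolve ideal_gen_ideal : core.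

Lemma mem_ideal_gen s p : p \in s -> ideal_gen s p.
Proof.
move=> ps; have lt : (index p s < size s)%N by rewrite index_mem.
exists (mkseq (fun i => (i == index p s)%:R) (size s)).
rewrite size_mkseq; split=> //; rewrite (bigD1 (Ordinal lt)) //= nth_mkseq //.
rewrite eqxx mul1r nth_index // big1 ?addr0 // => i /negPf ne.
by rewrite nth_mkseq // -[nat_of_ord i == _]/(i == Ordinal lt) ne mul0r.
Qed.

Lemma ideal_gen_min I s p :
  is_ideal I -> (forall q, q \in s -> I q) -> ideal_gen s p -> I p.
Proof.
move=> hI hs [c [_ ->]]; apply: ideal_bigsum => // i _.
by apply: ideal_mull => //; apply/hs/mem_nth.
Qed.

Lemma ideal_gen1P h p : ideal_gen [:: h] p <-> exists a, p = a * h.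
Proof.
split=> [[c [_ ->]]|[a ->]]; first by exists c`_0; rewrite big_ord1.
by apply: ideal_mull => //; apply: mem_ideal_gen; rewrite mem_head.
Qed.

Lemma ideal_gen2P f g p :
  ideal_gen [:: f; g] p <-> exists a b, p = a * f + b * g.
Proof.
split=> [[c [_ ->]]|[a [b ->]]].
  by exists c`_0, c`_1; rewrite big_ord_recl big_ord1.
by apply: idealD => //; apply: ideal_mull => //; apply: mem_ideal_gen;
  rewrite !inE eqxx ?orbT.
Qed.

Lemma ideal_gen_rconsP s h p :
  ideal_gen (rcons s h) p <-> exists a q, ideal_gen s q /\ p = h * a + q.
Proof.
split=> [[c [hc ->]]|[a [q [hq ->]]]].
  exists c`_(size s), (\sum_(i < size s) c`_i * s`_i); split.
    apply: ideal_bigsum => // i _; apply: ideal_mull => //.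
    exact/mem_ideal_gen/mem_nth.
  rewrite size_rcons big_ord_recr /= nth_rcons ltnn eqxx addrC mulrC.
  by congr (_ + _); apply: eq_bigr => i _; rewrite nth_rcons ltn_ord.
apply: idealD => //; first apply: ideal_mulr => //.
  by apply: mem_ideal_gen; rewrite mem_rcons mem_head.
apply: ideal_gen_min hq => // r hr; apply: mem_ideal_gen.
by rewrite mem_rcons inE hr orbT.
Qed.

Lemma ideal_sum_ideal I J :
  is_ideal I -> is_ideal J -> is_ideal (ideal_sum I J).
Proof.
move=> hI hJ; split; [|split].
- by exists 0, 0; rewrite addr0; split; [case: hI | split; [case: hJ |]].
- move=> _ _ [a [b [ha [hb ->]]]] [c [d [hc [hd ->]]]].
  exists (a + c), (b + d); rewrite addrACA.
  by split; [apply: idealD | split=> //; apply: idealD].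
- move=> r _ [a [b [ha [hb ->]]]]; exists (r * a), (r * b); rewrite mulrDr.
  by split; [apply: ideal_mull | split=> //; apply: ideal_mull].
Qed.

Lemma ideal_sum_l I J p : is_ideal J -> I p -> ideal_sum I J p.
Proof.
by move=> hJ hp; exists p, 0; rewrite addr0; split=> //; split=> //; case: hJ.
Qed.

Lemma ideal_sum_r I J p : is_ideal I -> J p -> ideal_sum I J p.
Proof. by move=> hI hp; exists 0, p; rewrite add0r; split=> //; case: hI. Qed.

Lemma prime_prod P (T : eqType) (r : seq T) (Q : pred T) (F : T -> R) :
  is_prime P -> P (\prod_(i <- r | Q i) F i) ->
  exists i, [/\ i \in r, Q i & P (F i)].
Proof.
case=> [_ [h1 hM]]; elim: r => [|x r IH]; first by rewrite big_nil.
rewrite big_cons; case: ifP => Qx.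
  case/hM => [hx|/IH [i [ir Qi hi]]]; first by exists x; rewrite mem_head.
  by exists i; rewrite inE ir orbT.
by case/IH => i [ir Qi hi]; exists i; rewrite inE ir orbT.
Qed.

Lemma prime_exp P p n : is_prime P -> P (p ^+ n) -> P p.
Proof.
case=> [_ [h1 hM]]; elim: n => [|n IH]; first by rewrite expr0.
by rewrite exprS => /hM [].
Qed.

(** * Powers of an ideal with two generators *)

Section Powers.
Variables f g : R.

Lemma pow2_ideal m : is_ideal (ideal_pow2 f g m).
Proof. exact: ideal_gen_ideal. Qed.
Hint Resolve pow2_ideal : core.

Lemma pow2_mon m i : (i <= m)%N -> ideal_pow2 f g m (f ^+ i * g ^+ (m - i)).
Proof.
move=> im; apply/mem_ideal_gen/mapP; exists i => //.
by rewrite mem_iota add0n ltnS.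
Qed.

Lemma pow2_0 p : ideal_pow2 f g 0 p.
Proof.
rewrite -[p]mulr1; apply: ideal_mull => //.
by have := @pow2_mon 0 0 isT; rewrite !expr0 mulr1.
Qed.

(** Splitting off one generator lets later facts about powers be proved by induction on [m], without
    handling monomials. *)
Lemma pow2SP m p : ideal_pow2 f g m.+1 p <->
  exists a b, [/\ ideal_pow2 f g m a, ideal_pow2 f g m b & p = f * a + g * b].
Proof.
have zero n : ideal_pow2 f g n 0 by case: (pow2_ideal n).
split.
  apply: (@ideal_gen_min (fun p => exists a b, [/\ _, _ & p = _])).
    split; [|split].
    - by exists 0, 0; split => //; ring.
    - move=> _ _ [a [b [ha hb ->]]] [c [d [hc hd ->]]].
      by exists (a + c), (b + d); split; [apply: idealD..|ring].
    - move=> r _ [a [b [ha hb ->]]].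
      by exists (r * a), (r * b); split; [apply: ideal_mull..|ring].
  (* The monomial without [f] goes into the [g] part; a factor [f] is split off from every other
     one. *)
  move=> q /mapP[[|i]]; rewrite mem_iota add0n => hi ->.
    exists 0, (g ^+ m); split=> //; last by rewrite subn0 exprS; ring.
    by have := @pow2_mon m 0 isT; rewrite expr0 mul1r subn0.
  exists (f ^+ i * g ^+ (m - i)), 0; split=> //; first exact: pow2_mon.
  by rewrite subSS exprS; ring.
have aux h : (h = f \/ h = g) -> forall a, ideal_pow2 f g m a ->
  ideal_pow2 f g m.+1 (h * a).
  move=> hh a; apply: (@ideal_gen_min (fun a => ideal_pow2 f g m.+1 (h * a))).
    split; [|split] => [|x y|r x]; rewrite ?mulr0 ?mulrDr //.
      exact: idealD.
    by rewrite mulrCA; apply: ideal_mull.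
  move=> q /mapP[i]; rewrite mem_iota add0n ltnS => hi ->.
  case: hh => ->.
    by rewrite mulrA -exprS -subSS; apply: pow2_mon.
  by rewrite mulrCA -exprS -subSn //; apply: pow2_mon; apply: ltnW.
by case=> a [b [ha hb ->]]; apply: idealD => //; apply: aux; auto.
Qed.

Lemma pow2_mul a b p q : ideal_pow2 f g a p -> ideal_pow2 f g b q ->
  ideal_pow2 f g (a + b) (p * q).
Proof.
elim: a p => [|a IH] p hp hq; first by apply: ideal_mull.
have [u [v [hu hv ->]]] := (pow2SP a p).1 hp.
by apply/pow2SP; exists (u * q), (v * q); split; [exact: IH..|ring].
Qed.

Lemma pow2_le a b p : (a <= b)%N -> ideal_pow2 f g b p -> ideal_pow2 f g a p.
Proof.
move/subnK <-; move: (b - a)%N => c; elim: c p => [|c IH] p //.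
rewrite addSn => /pow2SP [u [v [/IH hu /IH hv ->]]].
by apply: idealD => //; apply: ideal_mull.
Qed.

Lemma pow2_1 c d : ideal_pow2 f g 1 (c * f + d * g).
Proof.
apply/pow2SP; exists c, d; split; [exact: pow2_0..|ring].
Qed.

Lemma pow2_prod (T : eqType) (r : seq T) (Q : pred T) (F : T -> R) :
  (forall i, i \in r -> Q i -> ideal_pow2 f g 1 (F i)) ->
  ideal_pow2 f g (count Q r) (\prod_(i <- r | Q i) F i).
Proof.
elim: r => [|x r IH] hF; first exact: pow2_0.
have {}IH : ideal_pow2 f g (count Q r) (\prod_(i <- r | Q i) F i).
  by apply: IH => i ir; apply: hF; rewrite inE ir orbT.
rewrite big_cons /=; case: ifP => Qx //.
by apply: pow2_mul => //; apply: hF; rewrite ?mem_head.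
Qed.

Lemma pow2_exp h m : ideal_pow2 f g 1 h -> ideal_pow2 f g m (h ^+ m).
Proof.
move=> hh; elim: m => [|m IH]; first exact: pow2_0.
by rewrite exprS -add1n; apply: pow2_mul.
Qed.

(* [h] and [l] span the same ideal as [f] and [g]; all terms of the binomial
   expansion but the pure power of [h] are divisible by [l]. *)
Lemma pow2_exp_dvd h l a b c d m p :
  f = a * h + b * l -> g = c * h + d * l -> ideal_pow2 f g 1 h ->
  ideal_pow2 f g m.+1 p ->
  exists u q, ideal_pow2 f g m q /\ p = u * h ^+ m.+1 + l * q.
Proof.
move=> hf hg hh; elim: m p => [|m IH] p /pow2SP [u [v [hu hv ->]]].
  exists (a * u + c * v), (b * u + d * v); split; first exact: pow2_0.
  by rewrite [in LHS]hf [in LHS]hg expr1; ring.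
have [u1 [q1 [hq1 eu]]] := IH _ hu; have [v1 [r1 [hr1 ev]]] := IH _ hv.
exists (a * u1 + c * v1), (h * (a * q1 + c * r1) + (b * u + d * v)).
split; last first.
  have -> : f * u + g * v = h * (a * u + c * v) + l * (b * u + d * v).
    by rewrite [in LHS]hf [in LHS]hg; ring.
  have -> : h * (a * u + c * v) =
    (a * u1 + c * v1) * h ^+ m.+2 + l * h * (a * q1 + c * r1).
    by rewrite eu ev !exprS; ring.
  by ring.
apply: idealD => //; last by apply: idealD => //; apply: ideal_mull.
by rewrite -add1n; apply: pow2_mul => //; apply: idealD => //; apply: ideal_mull.
Qed.

End Powers.
End Ideals.
#[local] Hint Resolve ideal_gen_ideal pow2_ideal : core.

(** * Depth *)

Section Depth.
Variable k : fieldType.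
Notation R := {mpoly k[5]}.
Implicit Types (I J P : R -> Prop) (s : seq R) (p q f g h : R).

(* [Ext^2(k, R/I)] computed in two ways: the socle class [w] of [R/(I,z,u)]
   yields the [c]'s, which form a cocycle of the Koszul complex of
   [f1, f2, f3], hence a coboundary. *)
Lemma depth3_socle I z u f1 f2 f3 w :
  is_ideal I ->
  (forall g, I (z * g) -> I g) ->
  (forall g b, I (z * b + u * g) -> exists c, I (g + z * c)) ->
  regular_seq I [:: f1; f2; f3] ->
  (forall p, irrel p -> exists a b, I (p * w - (z * a + u * b))) ->
  exists a b, I (w - (z * a + u * b)).
Proof.
move=> hI hz hu [hirr [_ hreg]] hw.
(* Regularity of [f1], [f2], [f3], restated as cancellation modulo [I]. *)
have r1 g : I (f1 * g) -> I g.
  move=> h; case: (hreg 0%N isT g).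
    by apply: ideal_sum_l.
  move=> a [b [ha [hb ->]]]; apply: idealD => //.
  by apply: ideal_gen_min hb.
have r2 g b : I (f2 * g - f1 * b) -> exists c, I (g - f1 * c).
  move=> h; case: (hreg 1%N isT g).
    exists (f2 * g - f1 * b), (f1 * b); split=> //; split; last by rewrite subrK.
    by apply/ideal_gen1P; exists b; rewrite mulrC.
  move=> a [_ [ha [/ideal_gen1P [c ->] ->]]]; exists c.
  by have -> : a + c * f1 - f1 * c = a by ring.
have r3 g b c : I (f3 * g - f1 * b - f2 * c) ->
    exists d e, I (g - f1 * d - f2 * e).
  move=> h; case: (hreg 2%N isT g).
    exists (f3 * g - f1 * b - f2 * c), (f1 * b + f2 * c); split=> //.
    split; last by rewrite /=; ring.
    by apply/ideal_gen2P; exists b, c; ring.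
  move=> a [_ [ha [/ideal_gen2P [d [e ->]] ->]]]; exists d, e.
  by have -> : a + (d * f1 + e * f2) - f1 * d - f2 * e = a by ring.
have syz a b : I (z * a + u * b) -> exists c, I (b + z * c) /\ I (a - u * c).
  move=> h; have [c hc] := hu _ _ h; exists c; split=> //; apply: hz.
  have -> : z * (a - u * c) = (z * a + u * b) - u * (b + z * c) by ring.
  by apply: idealB => //; apply: ideal_mull.
have [|a1 [b1 h1]] := hw f1; first by apply: hirr; rewrite !inE eqxx.
have [|a2 [b2 h2]] := hw f2; first by apply: hirr; rewrite !inE eqxx orbT.
have [|a3 [b3 h3]] := hw f3; first by apply: hirr; rewrite !inE eqxx !orbT.
(* Eliminating [w] from two of the equations leaves a relation between [z] and [u], hence a Koszul
   coefficient [c]. *)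
have cross f a b f' a' b' : I (f * w - (z * a + u * b)) ->
    I (f' * w - (z * a' + u * b')) ->
    exists c, I ((f' * b - f * b') + z * c) /\ I ((f' * a - f * a') - u * c).
  move=> h h'; apply: syz.
  have -> : z * (f' * a - f * a') + u * (f' * b - f * b') =
    f * (f' * w - (z * a' + u * b')) - f' * (f * w - (z * a + u * b)) by ring.
  by apply: idealB => //; apply: ideal_mull.
have [c12 [hb12 ha12]] := cross _ _ _ _ _ _ h1 h2.
have [c13 [hb13 ha13]] := cross _ _ _ _ _ _ h1 h3.
have [c23 [hb23 ha23]] := cross _ _ _ _ _ _ h2 h3.
(* After multiplication by [z] the cocycle identity [f3 c12 - f2 c13 + f1 c23 = 0] holds modulo [I];
   so [c12] lies in [(f1, f2)] modulo [I]. *)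
have [|d [e hc]] := r3 c12 (- c23) c13.
  apply: hz.
  have -> : z * (f3 * c12 - f1 * - c23 - f2 * c13) =
    f3 * (f2 * b1 - f1 * b2 + z * c12) - f2 * (f3 * b1 - f1 * b3 + z * c13)
    + f1 * (f3 * b2 - f2 * b3 + z * c23) by ring.
  by apply: idealD => //; [apply: idealB => //|]; apply: ideal_mull.
(* Replacing [a1], [b1] by [a1 - u e], [b1 + z e] keeps [z a1 + u b1] and absorbs [c12]; the new
   [a1] and [b1] are divisible by [f1] modulo [I], and [f1] cancels at the end. *)
have [|r hr] := r2 (a1 - u * e) (a2 + u * d).
  have -> : f2 * (a1 - u * e) - f1 * (a2 + u * d) =
    (f2 * a1 - f1 * a2 - u * c12) + u * (c12 - f1 * d - f2 * e) by ring.
  by apply: idealD => //; apply: ideal_mull.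
have [|r' hr'] := r2 (b1 + z * e) (b2 - z * d).
  have -> : f2 * (b1 + z * e) - f1 * (b2 - z * d) =
    (f2 * b1 - f1 * b2 + z * c12) - z * (c12 - f1 * d - f2 * e) by ring.
  by apply: idealB => //; apply: ideal_mull.
exists r, r'; apply: r1.
have -> : f1 * (w - (z * r + u * r')) = (f1 * w - (z * a1 + u * b1))
  + z * (a1 - u * e - f1 * r) + u * (b1 + z * e - f1 * r') by ring.
by apply: idealD => //; [apply: idealD => //|]; apply: ideal_mull.
Qed.

Lemma regular_seq_take I (f : seq R) (d : nat) :
  regular_seq I f -> regular_seq I (take d f).
Proof.
case=> h1 [h2 h3]; split; [|split].
- by move=> a /mem_take; apply: h1.
- move=> [a [b [ha [hb e]]]]; apply: h2; exists a, b; split=> //; split=> //.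
  by apply: ideal_gen_min hb => // q /mem_take; apply: mem_ideal_gen.
- move=> j; rewrite size_take_min leq_min => /andP[jd js] g.
  by rewrite take_takel ?(ltnW jd) // nth_take //; apply: h3.
Qed.

Lemma prime_chain_le I d e : (d <= e)%N -> prime_chain I e -> prime_chain I d.
Proof.
move=> de [P [h1 h2]]; exists P; split=> j hj.
  by apply: h1; apply: leq_trans de.
by apply: h2; apply: leq_trans de.
Qed.

(** A chain of length [d] bounds the dimension from below, and a regular sequence may be truncated.
    Refuting Cohen-Macaulayness thus starts from a chain of length 3 alone. *)
Lemma cohen_macaulay_regular_seq I d :
  cohen_macaulay I -> prime_chain I d ->
  exists f : seq R, size f = d /\ regular_seq I f.
Proof.
move=> [e [[_ he] [f [hf hreg]]]] hd; exists (take d f).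
split; last exact: regular_seq_take.
rewrite size_takel // hf leqNgt; apply/negP => lt.
by apply: he; apply: prime_chain_le hd.
Qed.
End Depth.

(** * Krull dimension *)

Section Krull.
Variable k : fieldType.

(** All exponents in the [g i] are below [D], so their coefficients form a matrix with [D ^ n]
    columns and more rows, which has a nonzero left kernel. *)
Lemma lin_dep (n N D : nat) (g : 'I_N -> {mpoly k[n]}) :
  (forall i, msize (g i) <= D)%N -> (D ^ n < N)%N ->
  exists2 v : 'I_N -> k, (exists i, v i != 0) & \sum_i v i *: g i = 0.
Proof.
move=> hg hN.
pose M : 'M[k]_(N, #|{ffun 'I_n -> 'I_D}|) :=
  \matrix_(i, j) (g i)@_[multinom ((enum_val j : {ffun 'I_n -> 'I_D}) l : nat) | l < n].
have rk : (\rank M < N)%N.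
  apply: leq_ltn_trans (rank_leq_col _) _.
  by rewrite card_ffun !card_ord.
have : kermx M != 0 by rewrite kermx_eq0 /row_free neq_ltn rk.
case/rowV0Pn => v /sub_kermxP vM v0; exists (fun i => v 0 i).
  by apply/existsP; apply: contraR v0 => /existsPn h; apply/eqP/rowP => i;
    rewrite mxE; apply/eqP; move: (h i); rewrite negbK.
apply/mpolyP => m; rewrite raddf_sum /= mcoeff0.
have [lt|ge] := boolP [forall l, (m l < D)%N].
  pose e : {ffun 'I_n -> 'I_D} := [ffun l => Ordinal (forallP lt l)].
  have /rowP/(_ (enum_rank e)) := vM; rewrite !mxE => h.
  rewrite -[RHS]h; apply: eq_bigr => i _; rewrite mcoeffZ mxE; congr (_ * _@__).
  by apply/mnmP => l; rewrite mnmE enum_rankK ffunE.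
(* A monomial with an exponent at least [D] occurs in no [g i]. *)
case/forallPn: ge => l; rewrite -leqNgt => hl.
apply: big1 => i _; rewrite mcoeffZ memN_msupp_eq0 ?mulr0 //.
apply: msize_mdeg_ge; apply: leq_trans (hg i) _; apply: leq_trans hl _.
by rewrite mdegE (bigD1 l) //= leq_addr.
Qed.

Lemma msizeM_leq (n : nat) (p q : {mpoly k[n]}) :
  (msize (p * q) <= (msize p + msize q).-1)%N.
Proof.
have [->|p0] := eqVneq p 0; first by rewrite mul0r msize0.
have [->|q0] := eqVneq q 0; first by rewrite mulr0 msize0.
by rewrite msizeM.
Qed.

Lemma msize_prod_exp (n r N D : nat) (f : nat -> {mpoly k[n]}) (e : nat -> nat) :
  (forall i, (i < r)%N -> msize (f i) <= D.+1)%N ->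
  (forall i, (i < r)%N -> e i <= N)%N ->
  (msize (\prod_(0 <= i < r) f i ^+ e i) <= (r * (N * D)).+1)%N.
Proof.
have hX (p : {mpoly k[n]}) a : (msize p <= D.+1 -> msize (p ^+ a) <= (a * D).+1)%N.
  move=> hp; elim: a => [|a IH]; first by rewrite expr0 msize1.
  rewrite exprS; apply: leq_trans (msizeM_leq _ _) _; rewrite mulSn; lia.
elim: r => [|r IH] hf he; first by rewrite big_nil msize1.
rewrite big_nat_recr //=; apply: leq_trans (msizeM_leq _ _) _.
have := IH (fun i hi => hf i (ltnW hi)) (fun i hi => he i (ltnW hi)).
have := hX _ (e r) (hf r (ltnSn r)).
have : (e r * D <= N * D)%N by rewrite leq_mul2r he ?orbT.
rewrite mulSn; move: (msize _) (msize _) (e r * D)%N (N * D)%N (r * _)%N => x y u v w.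
lia.
Qed.

(* [n + 1] polynomials in [n] variables are algebraically dependent, by counting
   monomials. *)
Lemma alg_dep (n : nat) (f : nat -> {mpoly k[n]}) :
  exists N, exists2 c : {ffun 'I_n.+1 -> 'I_N} -> k,
    (exists e, c e != 0) &
    \sum_e c e *: \prod_(0 <= i < n.+1) f i ^+ e (inord i) = 0.
Proof.
(* The [N ^ n.+1] products have size at most [N * K], so they involve at most [(N * K) ^ n]
   monomials; [N > K ^ n] makes the products more numerous. *)
pose D := (\max_(i < n.+1) msize (f i)).+1.
pose K := (n.+1 * D).+1; pose N := (K ^ n).+1.
exists N.
pose T := {ffun 'I_n.+1 -> 'I_N}.
have [||v [i vi] hv] := @lin_dep n #|T| (N * K)%N
   (fun i => \prod_(0 <= j < n.+1) f j ^+ (enum_val i : T) (inord j)).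
- move=> i; apply: leq_trans (@msize_prod_exp n n.+1 N D f
     (fun j => (enum_val i : T) (inord j)) _ _) _.
  + move=> j hj; apply: leq_trans (leqW (leqnSn _)).
    exact: (leq_bigmax (Ordinal hj)).
  + by move=> j _; apply: ltnW.
  + by rewrite /K; nia.
- rewrite card_ffun !card_ord expnMn expnS mulnC ltn_pmul2r //.
  by rewrite expn_gt0.
exists (fun e => v (enum_rank e)); first by exists (enum_val i); rewrite enum_valK.
rewrite -[RHS]hv (reindex_onto (@enum_val T predT) enum_rank) /=.
  by apply: eq_big => [j|j _]; rewrite enum_valK ?eqxx.
by move=> e _; rewrite enum_rankK.
Qed.
End Krull.

(** * Chains of primes in [R] *)

Section Krull5.
Variable k : fieldType.
Notation R := {mpoly k[5]}.

(* Descend along the chain keeping only the terms whose leading exponents are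
   lexicographically minimal: a nonzero constant ends up in the last prime. *)
Lemma no_prime_chain6 : ~ prime_chain (fun p : R => p = 0) 6.
Proof.
case=> P [hP hlt].
have [f hf] : exists f : 'I_6 -> R, forall j : 'I_6, P j.+1 (f j) /\ ~ P j (f j).
  have H (j : 'I_6) : exists a, P j.+1 a /\ ~ P j a := (hlt j (ltn_ord j)).2.
  by have [f hf] := fin_all_exists H; exists f.
have hI (j : nat) : (j <= 6)%N -> is_ideal (P j) by move=> /hP [[]].
have [N [c [e0 ce0] hc]] := alg_dep (fun i => f (inord i)).
(* The powers of the first [j] elements have already been divided out. *)
pose term j (e : {ffun 'I_6 -> 'I_N}) :=
  c e *: \prod_(j <= i < 6) f (inord i) ^+ e (inord i).
suff H (j : nat) : (j <= 6)%N -> exists S : {set {ffun 'I_6 -> 'I_N}},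
    [/\ S != set0, forall e, e \in S -> c e != 0,
        forall e e', e \in S -> e' \in S -> forall i : 'I_6, (i < j)%N -> e i = e' i
      & P j (\sum_(e in S) term j e)].
  (* At the end [S] is a single exponent, and the sum is its nonzero coefficient. *)
  have [S [/set0Pn [e eS] hS hag]] := H 6%N isT.
  have -> : S = [set e].
    apply/setP => e'; rewrite inE; apply/idP/eqP => [e'S|->] //.
    by apply/ffunP => i; apply: hag.
  rewrite big_set1 /term big_geq // => h.
  have [_ [h1 _]] := (hP 6%N isT).1; apply: h1.
  have -> : 1 = (c e)^-1 *: (c e *: 1) :> R by rewrite scalerA mulVf ?scale1r // hS.
  by rewrite -mul_mpolyC; apply: ideal_mull => //; apply: hI.
elim: j => [_|j IH hj].
  exists [set e | c e != 0]; split=> //.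
  - by apply/set0Pn; exists e0; rewrite inE.
  - by move=> e; rewrite inE.
  have -> : \sum_(e in [set e | c e != 0]) term 0%N e = 0.
    rewrite -[RHS]hc [RHS](bigID (fun e => c e != 0)) /=.
    rewrite [X in _ = _ + X]big1 ?addr0; last first.
      by move=> e /negPn /eqP ->; rewrite scale0r.
    by apply: eq_bigl => e; rewrite inE.
  by case: (hI 0%N isT).
have [S [/set0Pn [e1 e1S] hS hag hsum]] := IH (ltnW hj).
pose o : 'I_6 := inord j.
have oj : o = j :> nat by rewrite inordK.
have [hfj hfj'] := hf o; rewrite oj in hfj hfj'.
case: (arg_minnP (fun e : {ffun 'I_6 -> 'I_N} => e o : nat) e1S) => e2 e2S hmin.
pose a := e2 o; exists [set e in S | e o == a].
have sub e : e \in [set e in S | e o == a] -> e \in S by rewrite inE => /andP[].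
split.
- by apply/set0Pn; exists e2; rewrite inE eqxx andbT.
- by move=> e /sub /hS.
- move=> e e' he he' i; rewrite ltnS leq_eqVlt => /predU1P [ij|].
    have -> : i = o by apply/val_inj; rewrite /= oj; exact: ij.
    by move: he he'; rewrite !inE => /andP[_ /eqP ->] /andP[_ /eqP ->].
  by apply: hag; apply: sub.
have hterm e : term j e = f o ^+ e o * term j.+1 e.
  by rewrite /term big_ltn // -/o scalerAr.
have hsub : forall p, P j p -> P j.+1 p by apply: (hlt j hj).1.
have [_ [_ hM]] := (hP j (ltnW hj)).1.
(* Since [a] is minimal, terms with a larger exponent keep a factor [f o] once [f o ^+ a] is taken
   out. *)
have e3 : \sum_(e in S) term j e =
  f o ^+ a * (\sum_(e in [set e in S | e o == a]) term j.+1 e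
   + f o * \sum_(e in S | e o != a) f o ^+ (e o - a).-1 * term j.+1 e).
  rewrite (bigID (fun e : {ffun 'I_6 -> 'I_N} => e o == a)) /= mulrDr; congr (_ + _).
    rewrite mulr_sumr; apply: eq_big => [e|e]; first by rewrite inE.
    by move=> /andP[_ /eqP ea]; rewrite hterm ea.
  rewrite !mulr_sumr; apply: eq_bigr => e /andP[eS ne].
  rewrite hterm !mulrA -exprSr -exprD; congr (_ ^+ _ * _).
  have := hmin e eS; rewrite -/a leq_eqVlt => /predU1P [E|lt].
    by case/eqP: ne; apply/val_inj.
  by rewrite addSn -addnS prednK ?subn_gt0 // subnKC // ltnW.
rewrite e3 in hsum; case: (hM _ _ hsum) => [|h].
  by move/(prime_exp (hP j (ltnW hj)).1).
apply: (@idealDr _ _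
  (f o * \sum_(e in S | e o != a) f o ^+ (e o - a).-1 * term j.+1 e)).
- exact: hI.
- by apply: ideal_mulr => //; apply: hI.
- by rewrite addrC; apply: hsub.
Qed.
End Krull5.

(** * Projections along linear forms *)

Section Linear.
Variable k : fieldType.
Notation R := {mpoly k[5]}.
Notation vect := ('I_5 -> k).
Implicit Types (p q h : R) (hs : seq R) (vs : seq vect) (v w : vect).

Lemma mpoly_closed_ind (P : R -> Prop) :
  (forall c, P c%:MP) -> (forall i, P 'X_i) ->
  (forall p q, P p -> P q -> P (p + q)) ->
  (forall p q, P p -> P q -> P (p * q)) -> forall p, P p.
Proof.
move=> hC hX hD hM; elim/mpolyind => [|c m p _ _ hp]; first by rewrite -mpolyC0.
apply: (hD) => //; rewrite -mul_mpolyC; apply: (hM) => //.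
rewrite mpolyXE_id; elim/big_ind: _ => //; first by rewrite -mpolyC1.
by move=> i _; elim: (m i) => [|a IH]; rewrite ?expr0 -?mpolyC1 // exprS; apply: hM.
Qed.

(** Every polynomial is congruent to its constant term modulo the variables. *)
Lemma irrel_min (J : R -> Prop) p :
  is_ideal J -> (forall i, J 'X_i) -> irrel p -> J p.
Proof.
move=> hJ hX; suff : J (p - (p.@[fun=> 0])%:MP).
  by rewrite /irrel => h e; rewrite e mpolyC0 subr0 in h.
elim/mpoly_closed_ind: p => [c|i|p q hp hq|p q hp hq].
- by rewrite mevalC subrr; case: hJ.
- by rewrite mevalXU mpolyC0 subr0.
- by rewrite mevalD mpolyCD opprD addrACA; apply: idealD.
rewrite mevalM mpolyCM; set a := _%:MP; set b := (meval _ q)%:MP.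
have -> : p * q - a * b = (p - a) * q + a * (q - b) by ring.
by apply: idealD => //; [apply: ideal_mulr|apply: ideal_mull].
Qed.

Definition lform p := exists a : vect, p = \sum_i a i *: 'X_i.

Lemma lform_var i : lform 'X_i.
Proof.
exists (fun j => (j == i)%:R); rewrite (bigD1 i) //= eqxx scale1r big1 ?addr0 //.
by move=> j /negPf ->; rewrite scale0r.
Qed.

Lemma lformD p q : lform p -> lform q -> lform (p + q).
Proof.
move=> [a ->] [b ->]; exists (fun i => a i + b i); rewrite -big_split.
by apply: eq_bigr => i _; rewrite scalerDl.
Qed.

Lemma lformZ c p : lform p -> lform (c *: p).
Proof.
move=> [a ->]; exists (fun i => c * a i); rewrite scaler_sumr.
by apply: eq_bigr => i _; rewrite scalerA.
Qed.

Lemma lform_meval0 p : lform p -> p.@[fun=> 0] = 0.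
Proof.
by move=> [a ->]; rewrite raddf_sum big1 // => i _; rewrite /= mevalZ mevalXU mulr0.
Qed.

Lemma lform_mevalD p v w : lform p -> p.@[fun i => v i + w i] = p.@[v] + p.@[w].
Proof.
move=> [a ->]; rewrite !raddf_sum -big_split; apply: eq_bigr => i _ /=.
by rewrite !mevalZ !mevalXU mulrDr.
Qed.

Lemma lform_mevalZ p c v : lform p -> p.@[fun i => c * v i] = c * p.@[v].
Proof.
move=> [a ->]; rewrite !raddf_sum mulr_sumr; apply: eq_bigr => i _ /=.
by rewrite !mevalZ !mevalXU mulrCA.
Qed.

(** On linear forms this is [p - sum_j p(v_j) h_j], extended to an algebra endomorphism. If the
    points are dual to [hs], its kernel is the ideal of [hs], and it splits the quotient map by this
    ideal. *)
Definition proj hs vs : R -> R := comp_mpoly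
  [tuple 'X_i - \sum_(j < size hs) nth (fun=> 0) vs j i *: hs`_j | i < 5].
HB.instance Definition _ hs vs :=
  GRing.RMorphism.copy (proj hs vs) (comp_mpoly
  [tuple 'X_i - \sum_(j < size hs) nth (fun=> 0) vs j i *: hs`_j | i < 5]).

Lemma proj_lform hs vs p : lform p ->
  proj hs vs p = p - \sum_(j < size hs) p.@[nth (fun=> 0) vs j] *: hs`_j.
Proof.
move=> [a ->]; rewrite /proj raddf_sum /=.
transitivity (\sum_i (a i *: 'X_i -
    \sum_(j < size hs) (a i * nth (fun=> 0) vs j i) *: hs`_j)).
  apply: eq_bigr => i _; rewrite comp_mpolyZ comp_mpolyXU -tnth_nth tnth_mktuple.
  rewrite scalerBr scaler_sumr; congr (_ - _).
  by apply: eq_bigr => j _; rewrite scalerA.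
rewrite sumrB exchange_big; congr (_ - _); apply: eq_bigr => j _ /=.
rewrite raddf_sum -scaler_suml; congr (_ *: _).
by apply: eq_bigr => i _; rewrite /= mevalZ mevalXU.
Qed.

Lemma proj_sub hs vs p : ideal_gen hs (p - proj hs vs p).
Proof.
elim/mpoly_closed_ind: p => [c|i|p q hp hq|p q hp hq].
- by rewrite /proj comp_mpolyC subrr; case: (ideal_gen_ideal hs).
- rewrite proj_lform; last exact: lform_var.
  rewrite opprB addrC subrK; apply: ideal_bigsum => // j _.
  by rewrite -mul_mpolyC; apply: ideal_mull => //; apply/mem_ideal_gen/mem_nth.
- by rewrite rmorphD opprD addrACA; apply: idealD.
rewrite rmorphM; have -> : p * q - proj hs vs p * proj hs vs q =
  (p - proj hs vs p) * q + proj hs vs p * (q - proj hs vs q) by ring.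
by apply: idealD => //; [apply: ideal_mulr|apply: ideal_mull].
Qed.

(** Linear independence of the forms [hs], witnessed by points on which they take dual values. *)
Definition dual hs vs := (forall h, h \in hs -> lform h) /\
  forall i j, (i < size hs)%N -> (j < size hs)%N ->
    (hs`_j).@[nth (fun=> 0) vs i] = (i == j)%:R.

Section Dual.
Variables (hs : seq R) (vs : seq vect).
Hypothesis hd : dual hs vs.

Lemma proj_gen h : h \in hs -> proj hs vs h = 0.
Proof.
case: hd => hl hm /(nthP 0)[j lt <-]; rewrite proj_lform; last exact/hl/mem_nth.
rewrite (bigD1 (Ordinal lt)) //= hm // eqxx scale1r big1 ?addr0 ?subrr // => i ne.
by rewrite hm // -[nat_of_ord i == _]/(i == Ordinal lt) (negPf ne) scale0r.
Qed.

Lemma proj_fix h : lform h ->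
  (forall j, (j < size hs)%N -> h.@[nth (fun=> 0) vs j] = 0) -> proj hs vs h = h.
Proof.
by move=> hl h0; rewrite proj_lform // big1 ?subr0 // => j _; rewrite h0 ?scale0r.
Qed.

Lemma proj_eq0 p : proj hs vs p = 0 <-> ideal_gen hs p.
Proof.
split=> [e|]; first by have := proj_sub hs vs p; rewrite e subr0.
case=> c [_ ->]; rewrite raddf_sum big1 // => i _.
by rewrite /= rmorphM /= (proj_gen (mem_nth 0 (ltn_ord i))) mulr0.
Qed.

(** The ideal is the kernel of [proj], an endomorphism of a domain. *)
Lemma dual_prime : is_prime (ideal_gen hs).
Proof.
split=> //; split=> [/proj_eq0|a b /proj_eq0].
  by rewrite rmorph1 => /eqP; rewrite oner_eq0.
rewrite rmorphM => /eqP; rewrite mulf_eq0 => /orP[]/eqP h; [left|right];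
  exact/proj_eq0.
Qed.

Lemma dual_irrel p : ideal_gen hs p -> irrel p.
Proof.
case: hd => hl _ [c [_ ->]]; rewrite /irrel raddf_sum big1 // => i _.
by rewrite /= mevalM (lform_meval0 (hl _ (mem_nth 0 (ltn_ord i)))) mulr0.
Qed.

Lemma dual_take d : dual (take d hs) (take d vs).
Proof.
case: hd => hl hm; split=> [h /mem_take|i j]; first exact: hl.
rewrite size_take_min !leq_min => /andP[id ii] /andP[jd jj].
by rewrite !nth_take // hm.
Qed.

(* The point [nth vs d] annihilates the first [d] forms but not the next one. *)
Lemma dual_nth_notin d : (d < size hs)%N -> ~ ideal_gen (take d hs) hs`_d.
Proof.
case: hd => hl hm lt [c [_ /(congr1 (meval (nth (fun=> 0) vs d)))]].
rewrite hm // eqxx raddf_sum big1 => [/eqP|i _]; first by rewrite oner_eq0.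
case: i => i /= ltd; have := ltd; rewrite size_take_min leq_min => /andP[id ii].
by rewrite /= mevalM nth_take // hm // gtn_eqF ?mulr0.
Qed.

Lemma ideal_gen_take_sub d p : ideal_gen (take d hs) p -> ideal_gen hs p.
Proof.
by apply: ideal_gen_min => // q /mem_take; apply: mem_ideal_gen.
Qed.

End Dual.
End Linear.

(** * Scalars avoiding finitely many linear conditions *)

Section Avoid.
Variable k : fieldType.
Hypothesis hchar : [pchar k] =i pred0.

(** In characteristic zero the integers below [size p] are distinct elements of [k], one more than
    the number of roots allowed. *)
Lemma exists_nonroot (p : {poly k}) : p != 0 -> exists x, p.[x] != 0.
Proof.
move=> p0; pose rs := [seq i%:R : k | i <- iota 0 (size p)].
have [/allP h|/allPn [x _ hx]] := boolP (all (root p) rs); last by exists x.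
have : (size rs < size p)%N.
  apply: max_poly_roots => //; first exact/allP.
  rewrite map_inj_uniq ?iota_uniq //.
  suff le (i j : nat) : i%:R = j%:R :> k -> (i <= j)%N.
    by move=> i j e; apply/eqP; rewrite eqn_leq (le _ _ e) (le _ _ (esym e)).
  move=> e; rewrite leqNgt; apply/negP => lt.
  have /pcharf0P/(_ (i - j)%N) := hchar.
  by rewrite natrB ?(ltnW lt) // e subrr eqxx => /esym; rewrite subn_eq0 leqNgt lt.
by rewrite size_map size_iota ltnn.
Qed.

(** A non-root of the product of the nonzero polynomials [c i + d i X] works. *)
Lemma avoid_roots (r : seq nat) (c d : nat -> k) :
  (forall i, i \in r -> (c i != 0) || (d i != 0)) ->
  exists x, forall i, i \in r -> c i + x * d i != 0.
Proof.
move=> h; have [|x hx] := @exists_nonroot (\prod_(i <- r) ((c i)%:P + (d i)%:P * 'X)).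
  rewrite prodf_seq_neq0; apply/allP => i /h /=; apply: contraTT.
  rewrite negbK => /eqP e; have := congr1 (fun p : {poly k} => (p`_0, p`_1)) e.
  by rewrite !coefD !coefC !coefCM !coefX /= mulr0 mulr1 addr0 add0r => -[-> ->];
    rewrite eqxx.
exists x => i ir; move: hx; rewrite horner_prod prodf_seq_neq0 => /allP /(_ i ir).
by rewrite /= !hornerE mulrC.
Qed.

Lemma bezout_pair (a b : k) : (a != 0) || (b != 0) -> exists x y, a * x + b * y = 1.
Proof.
case/orP=> h; [exists a^-1, 0|exists 0, b^-1]; by rewrite mulr0 ?addr0 ?add0r divff.
Qed.
End Avoid.

(** * Bases of linear forms, and powers under projection *)

Section Basis.
Variable k : fieldType.
Notation R := {mpoly k[5]}.
Notation vect := ('I_5 -> k).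

(** Duality says that the coefficient matrix [M] of the forms and the matrix [W] of the points
    satisfy [M W = 1]. Both are square, so [W M = 1], which expands each variable in the forms. *)
Lemma dual_full_expand (hs : seq R) (vs : seq vect) (p : R) :
  size hs = 5%N -> dual hs vs -> lform p ->
  p = \sum_(j < 5) p.@[nth (fun=> 0) vs j] *: hs`_j.
Proof.
move=> h5 [hl hm] [c ->].
have H (j : 'I_5) : exists a : vect, hs`_j = \sum_i a i *: 'X_i.
  by apply/hl/mem_nth; rewrite h5.
have [a ha] := fin_all_exists H.
pose M : 'M[k]_5 := \matrix_(j, i) a j i.
pose W : 'M[k]_5 := \matrix_(i, j) nth (fun=> 0) vs j i.
have /mulmx1C WM : M *m W = 1%:M.
  apply/matrixP => j l; rewrite !mxE.
  have := hm l j; rewrite h5 => /(_ (ltn_ord _) (ltn_ord _)).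
  rewrite ha raddf_sum eq_sym => <-; apply: eq_bigr => i _.
  by rewrite /= mevalZ mevalXU !mxE.
transitivity (\sum_i c i *: \sum_(j < 5) (nth (fun=> 0) vs j i) *: hs`_j).
  apply: eq_bigr => i _; congr (_ *: _).
  transitivity (\sum_l (W *m M) i l *: 'X_l : R).
    rewrite WM (bigD1 i) //= mxE eqxx scale1r big1 ?addr0 // => l /negPf ne.
    by rewrite mxE eq_sym ne scale0r.
  under [RHS]eq_bigr => j _ do rewrite ha scaler_sumr.
  rewrite exchange_big; apply: eq_bigr => l _ /=.
  rewrite mxE scaler_suml; apply: eq_bigr => j _.
  by rewrite !mxE scalerA.
under eq_bigr => i _ do rewrite scaler_sumr.
rewrite exchange_big; apply: eq_bigr => j _ /=.
rewrite raddf_sum scaler_suml; apply: eq_bigr => i _.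
by rewrite /= mevalZ mevalXU scalerA.
Qed.

Lemma dual_full_var (hs : seq R) (vs : seq vect) i :
  size hs = 5%N -> dual hs vs -> ideal_gen hs 'X_i.
Proof.
move=> h5 hd; rewrite (dual_full_expand h5 hd (lform_var _ i)).
apply: ideal_bigsum => // j _; rewrite -mul_mpolyC; apply: ideal_mull => //.
by apply/mem_ideal_gen/mem_nth; rewrite h5.
Qed.

Lemma ideal_gen_fix (f : {rmorphism R -> R}) (s : seq R) p :
  (forall q, q \in s -> f q = q) -> ideal_gen s p -> ideal_gen s (f p).
Proof.
move=> hf [c [_ ->]]; rewrite rmorph_sum; apply: ideal_bigsum => // i _.
rewrite rmorphM (hf _ (mem_nth 0 (ltn_ord i))); apply: ideal_mull => //.
exact/mem_ideal_gen/mem_nth.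
Qed.

Lemma ideal_gen_mapP (r : seq nat) (T : nat -> R) p : uniq r ->
  ideal_gen [seq T i | i <- r] p <-> exists c, p = \sum_(i <- r) c i * T i.
Proof.
move=> ur; split=> [[c [_ ->]]|[c ->]]; last first.
  rewrite big_seq; apply: ideal_bigsum => // i ir; apply: ideal_mull => //.
  by apply: mem_ideal_gen; apply: map_f.
exists (fun i => c`_(index i r)); rewrite size_map (big_nth 0%N) big_mkord.
by apply: eq_bigr => i _; rewrite (nth_map 0%N) // index_uniq.
Qed.

Lemma ideal_gen_meval (s : seq R) (w : vect) p :
  (forall q, q \in s -> q.@[w] = 0) -> ideal_gen s p -> p.@[w] = 0.
Proof.
move=> hs [c [_ ->]]; rewrite raddf_sum big1 // => i _.
by rewrite /= mevalM (hs _ (mem_nth 0 (ltn_ord i))) mulr0.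
Qed.

(** Two independent linear forms [f], [g] in the smallest prime prolong the chain downwards by [(f)]
    and [0], giving a chain of length 6 in [R]. *)
Lemma no_prime_chain4 (I : R -> Prop) :
  (forall P, is_prime P -> (forall p, I p -> P p) ->
     exists f g vs, [/\ dual [:: f; g] vs, P f & P g]) ->
  ~ prime_chain I 4.
Proof.
move=> hI [P [hP hlt]]; have [P0 PI] := hP 0%N isT.
have [f [g [vs [hd Pf Pg]]]] := hI _ P0 PI.
have sub : forall p, ideal_gen [:: f; g] p -> P 0%N p.
  move=> p; apply: ideal_gen_min; first by case: P0.
  by move=> q; rewrite !inE => /orP[]/eqP->.
suff : prime_chain (fun p : R => p = 0) 6 by exact: no_prime_chain6.
exists (fun j => if j is j'.+1 then if j' is j''.+1 then P j'' else ideal_gen [:: f]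
                 else fun p => p = 0).
have hd1 : dual [:: f] (take 1 vs) := dual_take hd 1.
split=> [[|[|j]] hj|[|[|j]] hj].
- split=> //; split; last first.
    by split=> [/eqP|a b /eqP]; rewrite ?oner_eq0 // mulf_eq0 => /orP[]/eqP; auto.
  by split=> //; split=> [a b -> ->|r a ->]; rewrite ?addr0 ?mulr0.
- by split=> [|a ->]; [exact: dual_prime hd1 | case: (ideal_gen_ideal [:: f])].
- by have [h _] := hP j hj; split=> // a ->; case: h => -[].
- split=> [a ->|]; first by case: (ideal_gen_ideal [:: f]).
  exists f; split; first by apply: mem_ideal_gen; rewrite mem_head.
  by have := dual_nth_notin hd1 (d := 0) isT; move=> h e; apply: h; rewrite e;
    case: (ideal_gen_ideal (Nil R)).
- split=> [a h|]; first by apply: sub; apply: (@ideal_gen_take_sub _ _ 1).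
  by exists g; split=> //; exact: (dual_nth_notin hd (d := 1) isT).
- exact: hlt.
Qed.

(** The projection fixes [f] and [g], so it changes only the coefficients of the monomials in them;
    dividing these changes by [h] stays within the power. *)
Lemma pow2_proj (f g h : R) (hs : seq R) (vs : seq vect) m b :
  proj (rcons hs h) vs f = f -> proj (rcons hs h) vs g = g ->
  ideal_pow2 f g m b -> proj (rcons hs h) vs b = 0 ->
  exists a q, [/\ ideal_pow2 f g m a, ideal_gen hs q & b = h * a + q].
Proof.
move=> hf hg; set pi := proj _ _ => hb b0.
suff : exists a q, [/\ ideal_pow2 f g m a, ideal_gen hs q & b - pi b = h * a + q].
  by rewrite b0 subr0.
elim: m b hb {b0} => [|m IH] b.
  move=> _; have /ideal_gen_rconsP [a [q [hq e]]] := proj_sub (rcons hs h) vs b.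
  by exists a, q; split=> //; exact: pow2_0.
case/pow2SP => u [v [/IH [a [q [ha hq eu]]] /IH [a' [q' [ha' hq' ev]]] ->]].
exists (f * a + g * a'), (f * q + g * q'); split.
- by apply/pow2SP; exists a, a'.
- by apply: idealD => //; apply: ideal_mull.
rewrite /pi rmorphD !rmorphM -/pi /=.
have -> : proj (rcons hs h) vs f = f by [].
have -> : proj (rcons hs h) vs g = g by [].
have -> : f * u + g * v - (f * pi u + g * pi v) =
  f * (u - pi u) + g * (v - pi v) by ring.
by rewrite eu ev; ring.
Qed.

(** Apply [pow2_proj] to [h * p] with [hs] empty and cancel [h]. *)
Lemma pow2_reg (f g h : R) (v : vect) m p :
  lform f -> lform g -> lform h -> h.@[v] = 1 -> f.@[v] = 0 -> g.@[v] = 0 ->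
  ideal_pow2 f g m (h * p) -> ideal_pow2 f g m p.
Proof.
move=> lf lg lh hv fv gv hp.
have hd : dual [:: h] [:: v].
  split=> [q|[|i] [|j]] //; first by rewrite inE => /eqP->.
have fix0 q : lform q -> q.@[v] = 0 -> proj [:: h] [:: v] q = q.
  by move=> lq q0; apply: proj_fix => // -[|j].
have [||||a [q [ha [c [_ ->]] e]]] := @pow2_proj f g h [::] [:: v] m (h * p).
- exact: fix0.
- exact: fix0.
- exact: hp.
- by rewrite rmorphM /= (proj_gen hd) ?mul0r // mem_head.
suff -> : p = a by [].
have h0 : h != 0 by apply: contra_eq_neq hv => ->; rewrite raddf0 eq_sym oner_eq0.
by apply: (mulfI h0); rewrite e big_ord0 addr0.
Qed.

End Basis.

(** * The ideal of Z in coordinates *)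

Section Core.
Variable k : fieldType.
Notation R := {mpoly k[5]}.
Notation vect := ('I_5 -> k).
Hypothesis hchar : [pchar k] =i pred0.
Variables (n m : nat) (A B : nat -> R) (s t C : R) (e0 e1 f1 f2 c0 : vect).
Hypothesis hd5 : dual [:: s; t; B 1%N; B 2%N; C] [:: e0; e1; f1; f2; c0].

(* Coordinates in the basis [s, t, B_1, B_2, C] of the linear forms, and in the
   dual basis of the space of points. *)
Definition basis_form (x0 x1 x2 x3 x4 : k) : R :=
  x0 *: s + x1 *: t + x2 *: B 1%N + x3 *: B 2%N + x4 *: C.
Definition basis_point (y0 y1 y2 y3 y4 : k) : vect := fun i =>
  y0 * e0 i + y1 * e1 i + y2 * f1 i + y3 * f2 i + y4 * c0 i.

Lemma lform_basis_form x0 x1 x2 x3 x4 : lform (basis_form x0 x1 x2 x3 x4).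
Proof.
case: hd5 => hl _; rewrite /basis_form.
by repeat apply: lformD; apply/lformZ/hl; rewrite !inE eqxx ?orbT.
Qed.

Lemma meval_basis x0 x1 x2 x3 x4 y0 y1 y2 y3 y4 :
  (basis_form x0 x1 x2 x3 x4).@[basis_point y0 y1 y2 y3 y4] =
    x0*y0 + x1*y1 + x2*y2 + x3*y3 + x4*y4.
Proof.
have hV h : lform h -> h.@[basis_point y0 y1 y2 y3 y4] =
  y0 * h.@[e0] + y1 * h.@[e1] + y2 * h.@[f1] + y3 * h.@[f2] + y4 * h.@[c0].
  by move=> lh; rewrite /basis_point !(lform_mevalD _ _ lh) !(lform_mevalZ _ _ lh).
case: hd5 => hl hm; rewrite /basis_form !mevalD !mevalZ.
have T i j : (i < 5)%N -> (j < 5)%N ->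
    ([:: s; t; B 1%N; B 2%N; C]`_j).@[nth (fun=> 0) [:: e0; e1; f1; f2; c0] i] =
    (i == j)%:R.
  exact: hm.
rewrite !hV; try by apply: hl; rewrite !inE eqxx ?orbT.
have T0 j := T 0%N j isT; have T1 j := T 1%N j isT; have T2 j := T 2%N j isT.
have T3 j := T 3%N j isT; have T4 j := T 4%N j isT.
have := (T0 0 isT, T0 1 isT, T0 2 isT, T0 3 isT, T0 4 isT)%N.
have := (T1 0 isT, T1 1 isT, T1 2 isT, T1 3 isT, T1 4 isT)%N.
have := (T2 0 isT, T2 1 isT, T2 2 isT, T2 3 isT, T2 4 isT)%N.
have := (T3 0 isT, T3 1 isT, T3 2 isT, T3 3 isT, T3 4 isT)%N.
have := (T4 0 isT, T4 1 isT, T4 2 isT, T4 3 isT, T4 4 isT)%N.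
rewrite /= => E4 E3 E2 E1 E0; rewrite !E0 !E1 !E2 !E3 !E4.
by ring.
Qed.

Lemma basis_form_C : basis_form 0 0 0 0 1 = C.
Proof. by rewrite /basis_form !scale0r !add0r scale1r. Qed.

Variables (a b p q : nat -> k).
Notation rg i := (1 <= i <= n)%N.
Hypothesis hn : (2 <= n)%N.
Hypothesis hA : forall i, rg i -> A i = basis_form (a i) (b i) 0 0 0.
Hypothesis hB : forall i, rg i -> B i = basis_form 0 0 (p i) (q i) 0.
Hypothesis hab : forall i, rg i -> (a i != 0) || (b i != 0).
Hypothesis hpq : forall i j, rg i -> rg j -> i != j -> p i * q j - p j * q i != 0.
Hypothesis hAA : a n.-1 * b n - a n * b n.-1 != 0.
Notation I := (IZ n m A B).

Lemma rg1 : rg 1. Proof. by rewrite /= ltnW. Qed.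
Lemma rg2 : rg 2. Proof. exact: hn. Qed.

Lemma dual_seq2 (h h' : R) v v' : lform h -> lform h' -> h.@[v] = 1 -> h'.@[v] = 0 ->
  h.@[v'] = 0 -> h'.@[v'] = 1 -> dual [:: h; h'] [:: v; v'].
Proof.
move=> l l' E1 E2 E3 E4; split=> [g|[|[|i]] [|[|j]]] //.
by rewrite !inE => /orP[]/eqP->.
Qed.

Lemma dual_seq3 (h h' h'' : R) v v' v'' : dual [:: h; h'] [:: v; v'] -> lform h'' ->
  h.@[v''] = 0 -> h'.@[v''] = 0 -> h''.@[v''] = 1 -> h''.@[v] = 0 -> h''.@[v'] = 0 ->
  dual [:: h; h'; h''] [:: v; v'; v''].
Proof.
move=> [hl hm] l'' E1 E2 E3 E4 E5; split=> [g|i j].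
  rewrite !inE orbA => /orP[gl|/eqP-> //]; by apply: hl; rewrite !inE.
move: i j => [|[|[|i]]] [|[|[|j]]] // _ _ /=; rewrite ?E1 ?E2 ?E3 ?E4 ?E5 //.
- exact: (hm 0%N 0%N isT isT).
- exact: (hm 0%N 1%N isT isT).
- exact: (hm 1%N 0%N isT isT).
- exact: (hm 1%N 1%N isT isT).
Qed.

Lemma pq_neq0 i : rg i -> (p i != 0) || (q i != 0).
Proof.
move=> ri; have [j rj ij] : exists2 j, rg j & i != j.
  by case: (eqVneq i 1%N) ri => [-> _|i1 ri]; [exists 2%N => //|exists 1%N => //]; lia.
apply: contraNT (hpq ri rj ij); rewrite negb_or !negbK => /andP[/eqP-> /eqP->].
by rewrite mul0r mulr0 subrr.
Qed.

Lemma dual_AB i : rg i -> exists x y x' y',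
  dual [:: A i; B i] [:: basis_point x y 0 0 0; basis_point 0 0 x' y' 0].
Proof.
move=> ri; have [x [y e]] := bezout_pair (hab ri).
have [x' [y' e']] := bezout_pair (pq_neq0 ri); exists x, y, x', y'.
by apply: dual_seq2; rewrite ?hA ?hB //; try exact: lform_basis_form;
  rewrite meval_basis ?(mulr0, mul0r, addr0, add0r).
Qed.

Lemma dual_ABC i : rg i -> exists vs, dual [:: A i; B i; C] vs.
Proof.
move=> ri; have [x [y [x' [y' hd]]]] := dual_AB ri.
exists [:: basis_point x y 0 0 0; basis_point 0 0 x' y' 0; basis_point 0 0 0 0 1].
by apply: dual_seq3 => //; rewrite -?basis_form_C ?hA ?hB //;
  try exact: lform_basis_form;
  rewrite meval_basis ?(mulr0, mul0r, addr0, add0r, mulr1).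
Qed.

Lemma prime_AB i : rg i -> is_prime (ideal_gen [:: A i; B i]).
Proof. by move=> /dual_AB [x [y [x' [y' /dual_prime]]]]. Qed.

Lemma AB_mulA i x : ideal_gen [:: A i; B i] (A i * x).
Proof. by apply/ideal_gen2P; exists x, 0; ring. Qed.

Lemma AB_mulB i x : ideal_gen [:: A i; B i] (B i * x).
Proof. by apply/ideal_gen2P; exists 0, x; ring. Qed.

Lemma AB_notin i h y0 y1 y2 y3 y4 : rg i -> a i * y0 + b i * y1 = 0 ->
  p i * y2 + q i * y3 = 0 -> h.@[basis_point y0 y1 y2 y3 y4] != 0 ->
  ~ ideal_gen [:: A i; B i] h.
Proof.
move=> ri ea eb /eqP hh /(@ideal_gen_meval _ _ (basis_point y0 y1 y2 y3 y4)) e;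
  apply/hh/e.
by move=> g; rewrite !inE => /orP[]/eqP->; rewrite ?hA ?hB // meval_basis
  ?(mul0r, addr0, add0r).
Qed.

Lemma IZ_ideal : is_ideal I.
Proof.
split; [|split].
- split=> [i _|]; first by case: (ideal_gen_ideal [:: A i; B i]).
  by case: (pow2_ideal (B 1%N) (B 2%N) m).
- move=> x y [h1 h2] [h3 h4]; split; last exact: idealD.
  by move=> i ri; apply: idealD; auto.
- move=> r x [h1 h2]; split; last exact: ideal_mull.
  by move=> i ri; apply: ideal_mull; auto.
Qed.
Hint Resolve IZ_ideal : core.

(** The components of the intersection are treated separately. The point [v] shows that [h] is
    independent of [B_1], [B_2], as the power of their ideal requires. *)
Lemma IZ_reg (h : R) v x : lform h -> h.@[v] = 1 -> (B 1%N).@[v] = 0 ->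
  (B 2%N).@[v] = 0 ->
  (forall i, rg i -> ~ ideal_gen [:: A i; B i] h) -> I (h * x) -> I x.
Proof.
move=> lh hv h1 h2 hi [hx hm]; split.
  move=> i ri; have [_ [_ hM]] := prime_AB ri.
  by case: (hM _ _ (hx i ri)) => // /(hi i ri).
apply: pow2_reg hm; last exact: h2.
- by rewrite (hB rg1); exact: lform_basis_form.
- by rewrite (hB rg2); exact: lform_basis_form.
- exact: lh.
- exact: hv.
- exact: h1.
Qed.

Lemma proj_IZ (hs : seq R) vs x : (forall i, rg i -> proj hs vs (A i) = A i) ->
  (forall i, rg i -> proj hs vs (B i) = B i) -> I x -> I (proj hs vs x).
Proof.
move=> fA fB [h1 h2]; split.
  move=> i ri; apply: ideal_gen_fix (h1 i ri) => g.
  by rewrite !inE => /orP[]/eqP->; rewrite /= ?fA ?fB.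
apply: ideal_gen_fix h2 => g /mapP[i _ ->].
by rewrite rmorphM !rmorphXn /= !fB ?rg1 ?rg2.
Qed.

Lemma B_pow1 i : rg i -> ideal_pow2 (B 1%N) (B 2%N) 1 (B i).
Proof.
move=> ri; rewrite (hB ri) /basis_form !scale0r !add0r addr0 -!mul_mpolyC.
exact: pow2_1.
Qed.


(** * A chain of primes over [I_Z] *)

Lemma rgn : rg n. Proof. by rewrite leqnn andbT ltnW. Qed.
Lemma rgn1 : rg n.-1. Proof. by lia. Qed.

(** A basis adapted to the last two lines. It is ordered so that its prefixes of length 2 to 5
    generate a chain of primes over [I_Z]. *)
Lemma dual_AB_last : exists vs,
  [/\ dual [:: A n; B n; C; B n.-1; A n.-1] vs & size vs = 5%N].
Proof.
have ne : n.-1 != n by lia.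
have hpqn := hpq rgn1 rgn ne.
pose d := a n.-1 * b n - a n * b n.-1; pose e := p n.-1 * q n - p n * q n.-1.
have e0' : e != 0 by apply: contra_neq hpqn; rewrite /e mulrC [p n * _]mulrC => <-;
  ring.
have hd0 : d != 0 := hAA.
(* Cramer's rule, with determinant [d] for the [A]'s and [e] for the [B]'s. *)
exists [:: basis_point (- b n.-1 / d) (a n.-1 / d) 0 0 0;
           basis_point 0 0 (- q n.-1 / e) (p n.-1 / e) 0;
           basis_point 0 0 0 0 1;
           basis_point 0 0 (q n / e) (- p n / e) 0;
           basis_point (b n / d) (- a n / d) 0 0 0]; split=> //.
split.
  move=> h; rewrite !inE (hA rgn) (hA rgn1) (hB rgn) (hB rgn1) -basis_form_C.
  by case/or4P => [|||/orP[]] /eqP->; exact: lform_basis_form.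
rewrite (hA rgn) (hA rgn1) (hB rgn) (hB rgn1) -basis_form_C.
by case=> [|[|[|[|[|i]]]]] [|[|[|[|[|j]]]]] // _ _; rewrite /= meval_basis /=;
  rewrite ?(mulr0, mul0r, addr0, add0r, mulr1) // /d /e; field.
Qed.

Lemma prime_chain3_IZ : prime_chain I 3.
Proof.
have [vs [hd _]] := dual_AB_last.
pose D := [:: A n; B n; C; B n.-1; A n.-1].
exists (fun j => ideal_gen (take (2 + j) D)); split=> j hj.
  split; first exact: dual_prime (dual_take hd _).
  move=> x [/(_ n rgn) hx _]; apply: (@ideal_gen_take_sub _ _ 2).
  by rewrite take_takel.
split=> [x hx|].
  by apply: (@ideal_gen_take_sub _ _ (2 + j)); rewrite take_takel // leq_add2l.
exists D`_(2 + j); split; last by apply: (dual_nth_notin hd).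
rewrite addnS (take_nth 0) //; apply: mem_ideal_gen.
by rewrite mem_rcons mem_head.
Qed.

(** * Divisibility by products of the [B_i], and the case [m < n - 1] *)

Lemma prod_B_dvd (r : seq nat) (Q : pred nat) i : i \in r -> Q i ->
  exists x, \prod_(j <- r | Q j) B j = B i * x.
Proof.
elim: r => // j r IH; rewrite inE => /predU1P[<-|ir] Qi; rewrite big_cons.
  by rewrite Qi; eexists.
have [x ->] := IH ir Qi; case: ifP => _; last by exists x.
by exists (B j * x); ring.
Qed.

Lemma prime_B i : rg i -> is_prime (ideal_gen [:: B i]).
Proof.
move=> ri; have [x [y e]] := bezout_pair (pq_neq0 ri).
apply: (@dual_prime _ _ [:: basis_point 0 0 x y 0]); rewrite (hB ri).
split=> [h|[|i'] [|j]] //; first by rewrite inE => /eqP->; exact: lform_basis_form.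
by move=> _ _; rewrite /= meval_basis !mul0r !(addr0, add0r).
Qed.

Lemma B_notin i h y0 y1 y4 (c : k) : rg i ->
  h.@[basis_point y0 y1 (c * q i) (- c * p i) y4] != 0 ->
  ~ ideal_gen [:: B i] h.
Proof.
move=> ri /eqP hh /(@ideal_gen_meval _ _ (basis_point y0 y1 (c * q i) (- c * p i) y4))
  e; apply/hh/e.
by move=> g; rewrite inE => /eqP->; rewrite hB // meval_basis; ring.
Qed.

(** The [B_i] are pairwise non-associate primes, so each new one divides the remaining cofactor. *)
Lemma prod_B_div (r : seq nat) x : uniq r -> (forall i, i \in r -> rg i) ->
  (forall i, i \in r -> ideal_gen [:: B i] x) ->
  exists y, x = (\prod_(i <- r) B i) * y.
Proof.
elim: r x => [|i r IH] x; first by exists x; rewrite big_nil mul1r.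
case/andP=> ir ur hr hx; have ri := hr i (mem_head _ _).
have [y e] : exists y, x = (\prod_(i <- r) B i) * y.
  by apply: IH => // j jr; [apply: hr|apply: hx]; rewrite inE jr orbT.
have /ideal_gen1P [z ez] : ideal_gen [:: B i] y.
  have [_ [_ hM]] := prime_B ri.
  have := hx i (mem_head _ _); rewrite e => /hM [|//].
  (* At the zero [(q_i, - p_i)] of [B_i], another [B_j] takes the nonzero value
     [p_j q_i - p_i q_j]. *)
  case/(prime_prod (prime_B ri)) => j [jr _].
  move/(ideal_gen_meval (w := basis_point 0 0 (q i) (- p i) 0)) => H.
  have rj : rg j by apply: hr; rewrite inE jr orbT.
  have ij : j != i by apply: contraNneq ir => <-.
  have := hpq rj ri ij; rewrite -[X in X != 0]
    (_ : (B j).@[basis_point 0 0 (q i) (- p i) 0] = _).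
    rewrite H ?eqxx // => g; rewrite inE => /eqP->; rewrite hB // meval_basis; ring.
  by rewrite hB // meval_basis; ring.
by exists z; rewrite big_cons e ez; ring.
Qed.

(* The first local cohomology of [R/(I, C)] contains the class [(0, ..., 0, Q)] of
   the product of the [R/(A_i, B_i)]; [w] is [u] times this class. *)
Lemma not_cohen_macaulay_IZ : (m < n.-1)%N -> ~ cohen_macaulay I.
Proof.
move=> mn /cohen_macaulay_regular_seq /(_ prime_chain3_IZ) [fs [hfs hreg]].
case: fs hfs hreg => [|g1 [|g2 [|g3 [|g4 fs]]]] // _ hreg.
(* This [x] makes [A_{n-1} + x A_n] proportional to no [A_i]. The two determinants cannot both
   vanish, as [A_{n-1}], [A_n] are independent and [A_i] is nonzero. *)
have [x hx] : exists x, forall i, i \in iota 1 n ->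
   (a n.-1 * b i - b n.-1 * a i) + x * (a n * b i - b n * a i) != 0.
  apply: avoid_roots => // i; rewrite mem_iota add1n ltnS => ri.
  rewrite -negb_and; apply/negP => /andP[/eqP E1 /eqP E2].
  have ai : a i * (a n.-1 * b n - a n * b n.-1) = 0.
    transitivity (a n * (a n.-1 * b i - b n.-1 * a i) - 
      a n.-1 * (a n * b i - b n * a i)).
      by ring.
    by rewrite E1 E2 !mulr0 subrr.
  have bi : b i * (a n.-1 * b n - a n * b n.-1) = 0.
    transitivity (b n * (a n.-1 * b i - b n.-1 * a i) - 
      b n.-1 * (a n * b i - b n * a i)).
      by ring.
    by rewrite E1 E2 !mulr0 subrr.
  move/eqP: ai; move/eqP: bi; rewrite !mulf_eq0 (negPf hAA) !orbF => b0 a0.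
  by have := hab ri; rewrite a0 b0.
have {}hx i : rg i -> (a n.-1 + x * a n) * b i - (b n.-1 + x * b n) * a i != 0.
  move=> ri; have := hx i; rewrite mem_iota add1n ltnS => /(_ ri).
  by apply: contra_neq => e; rewrite -[RHS]e; ring.
pose u := basis_form (a n.-1 + x * a n) (b n.-1 + x * b n) 0 0 0.
have uE : u = A n.-1 + x%:MP * A n.
  by rewrite (hA rgn) (hA rgn1) /u /basis_form mul_mpolyC !scalerDr !scalerDl !scalerA
    !mulr0
    !scale0r !addr0; rewrite addrACA.
(* [Q] has [n - 2 >= m] factors, so it lies in [(B_1, B_2)^m]; here [m < n - 1] enters. *)
pose Q := \prod_(i <- iota 1 n.-2) B i; pose w := A n.-1 * Q.
have Qpow : ideal_pow2 (B 1%N) (B 2%N) m Q.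
  apply: (@pow2_le _ _ _ _ n.-2); first by lia.
  have := @pow2_prod _ (B 1%N) (B 2%N) _ (iota 1 n.-2) predT B.
  rewrite count_predT size_iota; apply=> i; rewrite mem_iota => hi _.
  by apply: B_pow1; lia.
have uAB i : rg i -> ~ ideal_gen [:: A i; B i] u.
  move=> ri; apply: (@AB_notin i u (b i) (- a i) 0 0 0) => //; rewrite ?meval_basis;
    try ring.
  by apply: contra_neq (hx i ri) => <-; ring.
have CAB i : rg i -> ~ ideal_gen [:: A i; B i] C.
  move=> ri; apply: (@AB_notin i C 0 0 0 0 1) => //; try ring.
  by rewrite -{1}basis_form_C meval_basis ?(mul0r, mulr1, add0r) oner_eq0.
have lC : lform C by rewrite -basis_form_C; exact: lform_basis_form.
have evalC v0 v1 v2 v3 : C.@[basis_point v0 v1 v2 v3 0] = 0.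
  by rewrite -{1}basis_form_C meval_basis; ring.
have regC g : I (C * g) -> I g.
  apply: (@IZ_reg C (basis_point 0 0 0 0 1)) => //;
    first by rewrite -{1}basis_form_C meval_basis; ring.
    by rewrite (hB rg1) meval_basis; ring.
  by rewrite (hB rg2) meval_basis; ring.
have regu g : I (u * g) -> I g.
  have [|y0 [y1 e]] := @bezout_pair _ (a n.-1 + x * a n) (b n.-1 + x * b n).
    rewrite -negb_and; apply: contraNN (hx 1%N rg1) => /andP[/eqP-> /eqP->].
    by rewrite !mul0r subrr.
  apply: (@IZ_reg u (basis_point y0 y1 0 0 0)) => //; first exact: lform_basis_form.
  - by rewrite meval_basis !mul0r !addr0.
  - by rewrite (hB rg1) meval_basis; ring.
  - by rewrite (hB rg2) meval_basis; ring.
have hdC : dual [:: C] [:: basis_point 0 0 0 0 1].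
  split=> [h|[|i] [|j]] //; first by rewrite inE => /eqP->.
  by move=> _ _; rewrite /= -{1}basis_form_C meval_basis; ring.
pose pi := proj [:: C] [:: basis_point 0 0 0 0 1].
have pifix x0 x1 x2 x3 : pi (basis_form x0 x1 x2 x3 0) = basis_form x0 x1 x2 x3 0.
  apply: proj_fix; first exact: lform_basis_form.
  by case=> // _; rewrite meval_basis; ring.
(* The projection [pi] kills [C] and preserves [I] and [u]; so [u * pi g] is in [I], and [u]
   cancels. *)
have hu g c : I (C * c + u * g) -> exists d, I (g + C * d).
  move=> h; have /ideal_gen1P [d e] := proj_sub [:: C] [:: basis_point 0 0 0 0 1] g.
  exists (- d); have -> : g + C * - d = pi g by rewrite -/pi in e;
    apply: (addrI (- pi g)); rewrite addrA [- _ + _]addrC e addrC; ring.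
  apply: regu; have -> : u * pi g = pi (C * c + u * g).
    by rewrite /pi rmorphD !rmorphM /= (proj_gen hdC (mem_head _ _)) mul0r add0r -/pi
      (pifix _ _ _ _ : pi u = u).
  by apply: proj_IZ h => i ri; rewrite ?hA ?hB //; exact: pifix.
(* [y] and [z] take care of the last two lines, [Q] of the other lines and of the power. *)
have mixed y z : y = A n \/ y = B n -> z = A n.-1 \/ z = B n.-1 -> I (y * z * Q).
  move=> hy hz; split=> [i ri|]; last exact: ideal_mull.
  have [->|in1] := eqVneq i n.
    by case: hy => ->; rewrite -mulrA; [exact: AB_mulA|exact: AB_mulB].
  have [->|in2] := eqVneq i n.-1.
    by case: hz => ->; rewrite [y * _]mulrC -mulrA; [exact: AB_mulA|exact: AB_mulB].
  have [|//|z' e] := @prod_B_dvd (iota 1 n.-2) (fun=> true) i;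
    first by rewrite mem_iota; lia.
  by rewrite /Q e mulrCA; exact: AB_mulB.
have [|c [d hcd]] := @depth3_socle _ I C u g1 g2 g3 w IZ_ideal regC hu hreg.
  have [vs [hd _]] := dual_AB_last => y hy.
  have I0 : I 0 by case: IZ_ideal.
  pose J y := exists a b, I (y * w - (C * a + u * b)).
  have hJ : is_ideal J.
    split; [|split].
    - by exists 0, 0; have -> : 0 * w - (C * 0 + u * 0) = 0 by ring.
    - move=> z z' [c [d h]] [c' [d' h']]; exists (c + c'), (d + d').
      have -> : (z + z') * w - (C * (c + c') + u * (d + d')) =
        (z * w - (C * c + u * d)) + (z' * w - (C * c' + u * d')) by ring.
      exact: idealD.
    - move=> r z [c [d h]]; exists (r * c), (r * d).
      have -> : r * z * w - (C * (r * c) + u * (r * d)) =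
        r * (z * w - (C * c + u * d)) by ring.
      exact: ideal_mull.
  suff : J y by [].
  (* It suffices to multiply [w] by the five forms of the adapted basis. *)
  apply: irrel_min hy => // i.
  have hX : ideal_gen [:: A n; B n; C; B n.-1; A n.-1] 'X_i by apply: dual_full_var hd.
  apply: ideal_gen_min hX => // z.
  rewrite !inE => /or4P[||/eqP->|/orP[]] => [/eqP->|/eqP->||/eqP->|/eqP->].
  - exists 0, 0; have -> : A n * w - (C * 0 + u * 0) = A n * A n.-1 * Q by rewrite /w;
    ring.
    by apply: mixed; left.
  - exists 0, 0; have -> : B n * w - (C * 0 + u * 0) = B n * A n.-1 * Q by rewrite /w;
    ring.
    by apply: mixed; [right|left].
  - by exists w, 0; have -> : C * w - (C * w + u * 0) = 0 by ring.
  (* Here and in the next case [A_{n-1} = u - x A_n] is substituted; the part with [A_n] is in [I]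
     by [mixed]. *)
  - exists 0, (B n.-1 * Q).
    have -> : B n.-1 * w - (C * 0 + u * (B n.-1 * Q)) = - x%:MP * (A n * B n.-1 * Q).
      by rewrite uE /w; ring.
    by apply: ideal_mull => //; apply: mixed; [left|right].
  - exists 0, w.
    have -> : A n.-1 * w - (C * 0 + u * w) = - x%:MP * (A n * A n.-1 * Q).
      by rewrite uE /w; ring.
    by apply: ideal_mull => //; apply: mixed; left.
(* [u] cancels modulo the prime [(A_i, B_i, C)], since it does not vanish at the zero [(b_i, - a_i)]
   of [A_i]. *)
have key i z c' : rg i -> ideal_gen [:: A i; B i] (u * z - C * c') ->
  ideal_gen [:: A i; B i; C] z.
  move=> ri h; have [vs hd] := dual_ABC ri.
  have [_ [_ hM]] := dual_prime hd.
  have sub y : ideal_gen [:: A i; B i] y -> ideal_gen [:: A i; B i; C] y.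
    by move=> hy; apply/(@ideal_gen_rconsP _ [:: A i; B i] C); exists 0, y; split=> //;
      ring.
  case: (hM u z) => //.
    have -> : u * z = (u * z - C * c') + c' * C by ring.
    apply: idealD => //; first exact: sub.
    by apply: ideal_mull => //; apply: mem_ideal_gen; rewrite !inE eqxx !orbT.
  move/(ideal_gen_meval (w := basis_point (b i) (- a i) 0 0 0)) => H.
  case/eqP: (hx i ri); rewrite -[RHS]H; first by rewrite meval_basis; ring.
  move=> y; rewrite !inE => /or3P[]/eqP->; last exact: evalC.
    by rewrite hA // meval_basis; ring.
  by rewrite hB // meval_basis; ring.
have hd3 : dual [:: s; t; C] [:: basis_point 1 0 0 0 0; basis_point 0 1 0 0 0;
  basis_point 0 0 0 0 1].
  have -> : [:: s; t; C] = [:: basis_form 1 0 0 0 0; basis_form 0 1 0 0 0;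
    basis_form 0 0 0 0 1].
    by rewrite /basis_form !scale0r !scale1r !(add0r, addr0).
  apply: dual_seq3; [apply: dual_seq2|..]; try exact: lform_basis_form;
    rewrite meval_basis; ring.
(* Setting [s], [t], [C] to zero turns membership in [(A_i, B_i, C)] into divisibility by [B_i]. *)
pose pi3 := proj [:: s; t; C] [:: basis_point 1 0 0 0 0; basis_point 0 1 0 0 0;
  basis_point 0 0 0 0 1].
have pi3B i : rg i -> pi3 (B i) = B i.
  move=> ri; rewrite (hB ri); apply: proj_fix; first exact: lform_basis_form.
  by case=> [|[|[|]]] // _; rewrite meval_basis; ring.
have pi3A i : rg i -> pi3 (A i) = 0.
  move=> ri; apply/(proj_eq0 hd3);
    rewrite (hA ri) /basis_form !scale0r !addr0 -!mul_mpolyC.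
  by apply: idealD => //; apply: ideal_mull => //; apply: mem_ideal_gen;
    rewrite !inE eqxx ?orbT.
have pi3C : pi3 C = 0 by apply: (proj_gen hd3); rewrite !inE eqxx !orbT.
have key3 i z : rg i -> ideal_gen [:: A i; B i; C] z -> ideal_gen [:: B i] (pi3 z).
  move=> ri /(@ideal_gen_rconsP _ [:: A i; B i] C).
  case=> y [z' [/ideal_gen2P [y1 [y2 ->]] ->]].
  rewrite /pi3 !rmorphD !rmorphM /= -/pi3 (pi3A _ ri) (pi3B _ ri).
  by rewrite pi3C; apply/ideal_gen1P; exists (pi3 y2); ring.
have [hI _] := hcd.
(* [w] vanishes on the first [n - 1] lines; hence so does [d] modulo [C]. *)
have hd i : rg i -> (i < n)%N -> ideal_gen [:: B i] (pi3 d).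
  move=> ri lt; apply: (key3 _ _ ri); apply: (key i d (- c) ri).
  have : ideal_gen [:: A i; B i] w.
    have [->|in2] := eqVneq i n.-1; first exact: AB_mulA.
    have [|//|z' e] := @prod_B_dvd (iota 1 n.-2) (fun=> true) i;
      first by rewrite mem_iota; lia.
    by rewrite /w /Q e mulrCA; exact: AB_mulB.
  have -> : u * d - C * - c = w - (w - (C * c + u * d)) by ring.
  by move=> hw; apply: idealB => //; exact: hI.
have [|||y ey] := @prod_B_div (rcons (iota 1 n.-2) n.-1) (pi3 d).
- by rewrite rcons_uniq iota_uniq andbT mem_iota; lia.
- by move=> i; rewrite mem_rcons inE mem_iota; lia.
- by move=> i; rewrite mem_rcons inE mem_iota => hi; apply: hd; lia.
(* On the last line [w] agrees with [u * Q], so [d] agrees with [Q] modulo [C]. *)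
have : ideal_gen [:: B n] (pi3 (Q - d)).
  apply: (key3 _ _ rgn); apply: (key n _ c rgn).
  have -> : u * (Q - d) - C * c = w - (C * c + u * d) + A n * (x%:MP * Q).
    by rewrite /w uE; ring.
  by apply: (idealD (ideal_gen_ideal _) (hI n rgn)); exact: AB_mulA.
have -> : pi3 (Q - d) = Q * (1 - B n.-1 * y).
  rewrite /pi3 rmorphB /= -/pi3 ey -cats1 big_cat big_seq1 -/Q.
  have -> : pi3 Q = Q.
    rewrite /pi3 rmorph_prod; apply: eq_big_seq => i; rewrite mem_iota => hi.
    by apply: pi3B; lia.
  by rewrite /=; ring.
(* The contradiction: the prime [B_n] divides no factor of [Q], and [1 - B_{n-1} y] has constant
   term 1. *)
have [_ [_ hM]] := prime_B rgn => /hM [].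
  case/(prime_prod (prime_B rgn)) => i [hi _].
  have ri : rg i by move: hi; rewrite mem_iota; lia.
  apply: (@B_notin n _ 0 0 0 1 rgn); rewrite (hB ri) meval_basis.
  have ne : i != n by move: hi; rewrite mem_iota; lia.
  by apply: contra_neq (hpq ri rgn ne) => <-; ring.
move/(ideal_gen_meval (w := fun=> 0)) => H.
have lB i : rg i -> (B i).@[fun=> 0] = 0.
  by move=> ri; apply: lform_meval0; rewrite (hB ri); exact: lform_basis_form.
have : (1 : k) == 0; last by rewrite oner_eq0.
rewrite -[X in _ == X]H => [|z]; last by rewrite inE => /eqP->; exact: lB rgn.
by rewrite mevalB meval1 mevalM (lB _ rgn1) mul0r subr0.
Qed.


(** * Partial products of the [B_j], with and without one factor *)

Definition prodB l := \prod_(j <- iota 1 l) B j.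
Definition cofB l i := \prod_(j <- iota 1 l | j != i) B j.

Lemma iotaSr l : iota 1 l.+1 = rcons (iota 1 l) l.+1.
Proof. by rewrite -cats1 -[in LHS](addn1 l) iotaD add1n. Qed.

Lemma prodBS l : prodB l.+1 = prodB l * B l.+1.
Proof. by rewrite /prodB iotaSr -cats1 big_cat big_seq1. Qed.

Lemma cofBS l i : i != l.+1 -> cofB l.+1 i = cofB l i * B l.+1.
Proof.
by move=> ne; rewrite /cofB iotaSr -cats1 big_cat /= big_cons big_nil eq_sym ne mulr1.
Qed.

Lemma cofB_last l : cofB l.+1 l.+1 = prodB l.
Proof.
rewrite /cofB iotaSr -cats1 big_cat /= big_cons big_nil eqxx /= mulr1 /prodB.
rewrite big_seq_cond [RHS]big_seq; apply: eq_bigl => i; rewrite mem_iota.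
by case: (eqVneq i l.+1) => [->|]; rewrite ?andbT //; lia.
Qed.

Lemma cofBM l i : i \in iota 1 l -> cofB l i * B i = prodB l.
Proof. by move=> il; rewrite /prodB (bigD1_seq i) ?iota_uniq //= mulrC. Qed.

(** * Interpolation of binary forms and generators of [I_Z] *)

Section Interpolation.
Variable lam : k.
Hypothesis hlam : forall i, rg i -> q i - lam * p i != 0.
(** This is the form [E]; [hlam] says that it is proportional to no [B_i]. *)
Definition gen_form : R := basis_form 0 0 1 lam 0.
Notation Pow := (ideal_pow2 (B 1%N) (B 2%N)).

Lemma basis_form_comb c d x0 x1 x2 x3 x4 y0 y1 y2 y3 y4 :
  c%:MP * basis_form x0 x1 x2 x3 x4 + d%:MP * basis_form y0 y1 y2 y3 y4 =
  basis_form (c*x0 + d*y0) (c*x1 + d*y1) (c*x2 + d*y2) (c*x3 + d*y3) (c*x4 + d*y4).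
Proof. by rewrite /basis_form -!mul_mpolyC !mpolyCD !mpolyCM; ring. Qed.

Lemma gen_form_comb i j : rg i -> rg j -> i != j ->
  exists c d : k, gen_form = c%:MP * B i + d%:MP * B j.
Proof.
move=> ri rj ij; have D0 := hpq ri rj ij; pose D := p i * q j - p j * q i.
exists ((q j - lam * p j) / D), ((lam * p i - q i) / D).
rewrite (hB ri) (hB rj) basis_form_comb /gen_form /D; congr basis_form; field;
  exact: D0.
Qed.

Lemma B12_comb i : rg i -> exists c d c' d' : k,
  B 1%N = c%:MP * gen_form + d%:MP * B i /\ B 2%N = c'%:MP * gen_form + d'%:MP * B i.
Proof.
move=> ri; have D0 := hlam ri; pose D := q i - lam * p i.
exists (q i / D), (- lam / D), (- p i / D), (1 / D).
rewrite (hB ri) !basis_form_comb /D; split.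
  transitivity (basis_form 0 0 1 0 0);
    first by rewrite /basis_form !scale0r scale1r !addr0 add0r.
  by congr basis_form; field; exact: D0.
transitivity (basis_form 0 0 0 1 0);
  first by rewrite /basis_form !scale0r scale1r !addr0 !add0r.
by congr basis_form; field; exact: D0.
Qed.

Lemma gen_form_pow1 : Pow 1 gen_form.
Proof.
rewrite /gen_form /basis_form !scale0r !add0r addr0 -!mul_mpolyC; exact: pow2_1.
Qed.

Definition prodB_pow l d x := exists z, Pow d z /\ x = prodB l * z.

Lemma prodB_pow_ideal l d : is_ideal (prodB_pow l d).
Proof.
split; [|split].
- by exists 0; rewrite mulr0; split=> //; case: (pow2_ideal (B 1%N) (B 2%N) d).
- move=> _ _ [z [hz ->]] [z' [hz' ->]]; exists (z + z'); rewrite mulrDr.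
  by split=> //; apply: idealD.
- by move=> r _ [z [hz ->]]; exists (r * z); rewrite mulrCA; split=> //;
  apply: ideal_mull.
Qed.
Hint Resolve prodB_pow_ideal : core.

(** Induction on [l]. In an old generator one factor [E] is written in [B_i] and [B_{l+1}], which
    completes the cofactors of [l+1] and of [i]. In the remainder, a form is a multiple of a power
    of [E] up to a multiple of [B_{l+1}]. *)
Lemma pow2_interpolation l x : (l <= n)%N -> (l <= m.+1)%N -> Pow m x ->
  ideal_sum (ideal_gen [seq cofB l i * gen_form ^+ (m.+1 - l) | i <- iota 1 l])
            (prodB_pow l (m - l)) x.
Proof.
elim: l x => [|l IH] x ln lm hx.
  apply: ideal_sum_r => //; exists x; rewrite subn0; split=> //.
  by rewrite /prodB big_nil mul1r.
have rl : rg l.+1 by lia.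
set T := ideal_sum _ _; have hT : is_ideal T by apply: ideal_sum_ideal.
have gen i : i \in iota 1 l.+1 -> T (cofB l.+1 i * gen_form ^+ (m - l)).
  move=> hi; apply: ideal_sum_l => //; apply: mem_ideal_gen.
  exact: (map_f (fun i => cofB l.+1 i * gen_form ^+ (m.+1 - l.+1)) hi).
have ml : (m.+1 - l = (m - l).+1)%N by rewrite subSn.
have last_mem : l.+1 \in iota 1 l.+1 by rewrite mem_iota; lia.
have [u [_ [hu [[z [hz ->]] ->]]]] := IH x (ltnW ln) (ltnW lm) hx.
apply: idealD => //.
  apply: ideal_gen_min hu => // _ /mapP[i hi ->].
  have hil : i \in iota 1 l.+1 by move: hi; rewrite !mem_iota; lia.
  have ri : rg i by move: hi; rewrite mem_iota; lia.
  have ne : i != l.+1 by move: hi; rewrite mem_iota; lia.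
  have [c [d e]] := gen_form_comb ri rl ne.
  have -> : cofB l i * gen_form ^+ (m.+1 - l) =
    c%:MP * (cofB l.+1 l.+1 * gen_form ^+ (m - l)) +
     d%:MP * (cofB l.+1 i * gen_form ^+ (m - l)).
    by rewrite ml exprS {1}e (cofBS ne) cofB_last -(cofBM hi); ring.
  by apply: idealD => //; apply: ideal_mull => //; apply: gen.
(* If [m = l], the remainder is already a multiple of the cofactor of [l+1], with [E] to the power
   0. *)
case em : (m - l)%N hz gen => [|d] hz gen.
  by rewrite -cofB_last mulrC -[cofB _ _]mulr1 -(expr0 gen_form);
    apply: ideal_mull => //; apply: gen.
have [c1 [d1 [c2 [d2 [e1' e2']]]]] := B12_comb rl.
have [w [z' [hz' ->]]] := pow2_exp_dvd e1' e2' gen_form_pow1 hz.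
rewrite mulrDr; apply: idealD => //.
  by rewrite mulrCA -cofB_last; apply: ideal_mull => //; apply: gen.
apply: ideal_sum_r => //; exists z'; rewrite prodBS mulrA; split=> //.
by have -> : (m - l.+1)%N = d by lia.
Qed.

Hypothesis hmn : (n.-1 <= m)%N.
Notation H i := (cofB n i * gen_form ^+ (m.+1 - n)).
Notation r := (iota 1 n).

Lemma rgE i : (i \in r) = rg i. Proof. by rewrite mem_iota add1n ltnS. Qed.

Lemma meval_gen_form_neq0 i c y0 y1 y4 : rg i -> c != 0 ->
  gen_form.@[basis_point y0 y1 (c * q i) (- c * p i) y4] != 0.
Proof.
move=> ri c0'; rewrite meval_basis.
have -> : 0 * y0 + 0 * y1 + 1 * (c * q i) + lam * (- c * p i) + 0 * y4 =
  c * (q i - lam * p i) by ring.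
by rewrite mulf_neq0 ?hlam.
Qed.

Lemma meval_H_neq0 i c y0 y1 y4 : rg i -> c != 0 ->
  (H i).@[basis_point y0 y1 (c * q i) (- c * p i) y4] != 0.
Proof.
move=> ri c0'; rewrite mevalM mulf_neq0 //; last first.
  by rewrite rmorphXn expf_neq0 //= meval_gen_form_neq0.
rewrite rmorph_prod prodf_seq_neq0; apply/allP => j; rewrite rgE => rj /=.
apply/implyP => ji; rewrite (hB rj) meval_basis.
have -> : 0 * y0 + 0 * y1 + p j * (c * q i) + q j * (- c * p i) + 0 * y4 =
  c * (p j * q i - p i * q j) by ring.
by rewrite mulf_neq0 ?hpq.
Qed.

Lemma cofB_dvd i j : rg j -> j != i -> exists x, cofB n i = B j * x.
Proof. by move=> rj ji; apply: prod_B_dvd => //; rewrite rgE. Qed.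

Lemma prodB_dvd j : rg j -> exists x, prodB n = B j * x.
Proof. by move=> rj; apply: (@prod_B_dvd _ (fun=> true)) => //; rewrite rgE. Qed.

(** Expand [x] by interpolation. Modulo [(A_i, B_i)] only the term [c_i H_i] survives, and [H_i] is
    not in this prime, so [c_i] is; its [B_i] part completes [H_i] to a multiple of the full
    product. *)
Lemma IZ_gens x : I x -> ideal_sum (ideal_gen [seq A i * H i | i <- r])
                                   (prodB_pow n (m - n)) x.
Proof.
case=> hx hm; have nm : (n <= m.+1)%N by lia.
have [y [_ [hy [[z [hz ->]] ex]]]] := pow2_interpolation (leqnn n) nm hm.
have [c ey] := (ideal_gen_mapP _ _ (iota_uniq 1 n)).1 hy; rewrite ey in ex.
set T := ideal_sum _ _.
have hT : is_ideal T by apply: ideal_sum_ideal.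
have hF d : Pow (m - n) d -> T (prodB n * d) by move=> hd; apply: ideal_sum_r => //;
  exists d.
rewrite ex; apply: idealD => //; last exact: hF.
rewrite big_seq; apply: ideal_bigsum => // i; rewrite rgE => ri.
have : ideal_gen [:: A i; B i] (c i * H i).
  have := hx i ri; rewrite ex (bigD1_seq i) ?iota_uniq ?rgE //= addrAC -addrA addrC.
  apply: idealDr => //; apply: idealD => //.
    by have [w ->] := prodB_dvd ri; rewrite -mulrA; exact: AB_mulB.
  apply: ideal_bigsum => // j ji; have [|w ->] := @cofB_dvd j i ri;
    first by rewrite eq_sym.
  by rewrite mulrCA -!mulrA; exact: AB_mulB.
have [_ [_ hM]] := prime_AB ri => /hM [/ideal_gen2P [a' [b' ->]]|h]; last first.
  by case: (AB_notin ri _ _ (meval_H_neq0 0 0 0 ri (oner_neq0 k)) h); ring.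
have -> : (a' * A i + b' * B i) * H i =
   a' * (A i * H i) + prodB n * (b' * gen_form ^+ (m.+1 - n)).
  by rewrite -(@cofBM n i) ?rgE //; ring.
apply: idealD => //; last first.
  apply: hF; apply: ideal_mull => //; apply: (@pow2_le _ _ _ _ (m.+1 - n));
    first by lia.
  by apply: pow2_exp; exact: gen_form_pow1.
apply: ideal_mull => //; apply: ideal_sum_l => //; apply: mem_ideal_gen.
by apply: (map_f (fun i => A i * H i)); rewrite rgE.
Qed.

(** Together with [prodB_pow_IZ] this is the converse of [IZ_gens]; the degree in the [B]'s is
    [(n - 1) + (m + 1 - n) = m]. *)
Lemma AH_IZ i : rg i -> I (A i * H i).
Proof.
move=> ri; split=> [j rj|].
  have [<-|ij] := eqVneq i j; first exact: AB_mulA.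
  have [|x ->] := @cofB_dvd i j rj; first by rewrite eq_sym.
  by rewrite mulrCA -!mulrA; exact: AB_mulB.
apply: ideal_mull => //; apply: (@pow2_le _ _ _ _ (n.-1 + (m.+1 - n))); first by lia.
apply: pow2_mul; last by apply: pow2_exp; exact: gen_form_pow1.
have := @pow2_prod _ (B 1%N) (B 2%N) _ r (fun j => j != i) B.
have -> : count (fun j => j != i) r = n.-1.
  have := count_predC (pred1 i) r; rewrite size_iota count_uniq_mem ?iota_uniq //.
  rewrite rgE ri /= => e; 
  have -> : n.-1 = (1 + count (predC (pred1 i)) r)%N.-1 by rewrite e.
  by [].
by apply=> j; rewrite rgE => rj _; apply: B_pow1.
Qed.

Lemma prodB_pow_IZ x : Pow (m - n) x -> I (prodB n * x).
Proof.
move=> hx; split=> [j rj|].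
  by have [y ->] := prodB_dvd rj; rewrite -mulrA; exact: AB_mulB.
apply: (@pow2_le _ _ _ _ (n + (m - n))); first by lia.
apply: pow2_mul => //.
have := @pow2_prod _ (B 1%N) (B 2%N) _ r predT B; rewrite count_predT size_iota.
by apply=> j; rewrite rgE => rj _; apply: B_pow1.
Qed.

(** * A regular sequence of length 3 *)

Section Regular.
Variable mu : k.
Hypothesis hmu : forall i, rg i -> a i + mu * b i != 0.
(** The forms [C], [s - E], [t - mu E]. *)
Definition params := [:: C; basis_form 1 0 (-1) (- lam) 0;
  basis_form 0 1 (- mu) (- (mu * lam)) 0].
Definition params_dual := [:: basis_point 0 0 0 0 1; basis_point 1 0 0 0 0;
  basis_point 0 1 0 0 0].

Lemma dual_params : dual params params_dual.
Proof.
rewrite /params -basis_form_C; split=> [h|].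
  by rewrite !inE => /or3P[]/eqP->; exact: lform_basis_form.
by case=> [|[|[|i]]] [|[|[|j]]] // _ _; rewrite /= meval_basis /=; ring.
Qed.

(** A common zero of [B_i] and [params], where [E] takes the value [q_i - lam p_i]. The factors [1]
    and [-1] match the scalar [c] of [meval_H_neq0]. *)
Notation pt i := (basis_point ((q i - lam * p i)) (mu * (q i - lam * p i)) (1 * q i)
  (-1 * p i) 0).

Lemma eval_params i h : h \in params -> h.@[pt i] = 0.
Proof.
by rewrite /params -basis_form_C !inE => /or3P[]/eqP->; rewrite meval_basis; ring.
Qed.

Lemma proj_params_eval j i x :
  (proj (take j params) (take j params_dual) x).@[pt i] = x.@[pt i].
Proof.
apply/eqP; rewrite -subr_eq0 -mevalB -oppr_eq0 -mevalN opprB; apply/eqP.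
apply: ideal_gen_meval (proj_sub _ (take j params_dual) x).
by move=> h /mem_take; apply: eval_params.
Qed.

Lemma proj_params_B j i : rg i -> proj (take j params) (take j params_dual) (B i) = B i.
Proof.
move=> ri; rewrite (hB ri); apply: proj_fix; first exact: lform_basis_form.
move=> l; rewrite size_take_min leq_min => /andP[lj l3].
rewrite nth_take //; case: l l3 {lj} => [|[|[|]]] // _; rewrite meval_basis; ring.
Qed.

(** The element [x] of [I] vanishes modulo the first [j + 1] parameters. This relation between the
    generators of [I] is lifted, which makes [x] a multiple of [th] by an element of [I], modulo
    [K]. *)
Lemma params_step j g : (j < 3)%N ->
  ideal_sum I (ideal_gen (take j params)) (params`_j * g) ->
  ideal_sum I (ideal_gen (take j params)) g.
Proof.
move=> j3 [x [y [hx [hy exy]]]].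
set K := ideal_gen _ in hy *; set th := params`_j in exy.
have hK : is_ideal K by exact: ideal_gen_ideal.
pose hd := dual_take dual_params j.+1.
pose pi := proj (take j.+1 params) (take j.+1 params_dual).
have eqr : take j.+1 params = rcons (take j params) th by rewrite (take_nth 0).
have decomp z : ideal_gen (take j.+1 params) z <-> exists c d, K d /\ z = th * c + d.
  by rewrite eqr; exact: ideal_gen_rconsP.
have piB i : rg i -> pi (B i) = B i by exact: proj_params_B.
have pi0 z : pi z = 0 <-> ideal_gen (take j.+1 params) z := proj_eq0 hd z.
have pix : pi x = 0.
  apply/pi0/decomp; exists g, (- y); rewrite exy addrK; split=> //.
  exact: idealN.
have [u [_ [hu [[z [hz ->]] ex]]]] := IZ_gens hx.
have [c eu] := (ideal_gen_mapP _ _ (iota_uniq 1 n)).1 hu; rewrite eu in ex.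
(* Modulo [B_i] only the [i]-th term of [pi x = 0] remains, and [A_i H_i] does not vanish at [pt i];
   so [B_i] divides [pi (c i)]. *)
have pic i : rg i -> ideal_gen [:: B i] (pi (c i)).
  move=> ri; have [hI [_ hM]] := prime_B ri.
  have : ideal_gen [:: B i] (pi (c i * (A i * H i))).
    have dvdB w : ideal_gen [:: B i] (pi (B i * w)).
      by rewrite /pi rmorphM /= -/pi piB //; apply/ideal_gen1P; exists (pi w);
        rewrite mulrC.
    have : ideal_gen [:: B i] (pi x) by rewrite pix; case: hI.
    rewrite ex (bigD1_seq i) ?iota_uniq ?rgE //= -addrA addrC /pi rmorphD.
    apply: idealDr => //=; rewrite rmorphD; apply: idealD => //=; last first.
      by have [w ->] := prodB_dvd ri; rewrite -mulrA; exact: dvdB.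
    rewrite rmorph_sum; apply: ideal_bigsum => // l li /=.
    have [|w ->] := @cofB_dvd l i ri; first by rewrite eq_sym.
    have -> : c l * (A l * (B i * w * gen_form ^+ (m.+1 - n))) =
      B i * (c l * A l * w * gen_form ^+ (m.+1 - n)) by ring.
    exact: dvdB.
  rewrite /pi rmorphM /= => /hM [//|] /(ideal_gen_meval (w := pt i)) h0; exfalso.
  have : (A i * H i).@[pt i] != 0.
    rewrite mevalM mulf_neq0 ?meval_H_neq0 ?oner_eq0 // hA // meval_basis.
    have -> : a i * (q i - lam * p i) + b i * (mu * (q i - lam * p i)) +
      0 * (1 * q i) + 0 * (-1 * p i) + 0 * 0 =
        (q i - lam * p i) * (a i + mu * b i) by ring.
    by rewrite mulf_neq0 ?hlam ?hmu.
  rewrite -(proj_params_eval j.+1) h0 ?eqxx // => h; rewrite inE => /eqP->.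
  by rewrite hB // meval_basis; ring.
(* In [c_i A_i H_i], the [B_i] part of [c_i] moves to the multiples of the full product, the rest to
   [th] and [K]. *)
pose X w := exists a' b' d, [/\ I a', Pow (m - n) b', K d &
  w = th * a' + prodB n * b' + d].
have I0 : I 0 by case: IZ_ideal.
have P0 d : Pow d 0 by case: (pow2_ideal (B 1%N) (B 2%N) d).
have K0 : K 0 by case: hK.
have hX : is_ideal X.
  split; [|split].
  - by exists 0, 0, 0; split=> //; ring.
  - move=> _ _ [a1 [b1 [d1 [? ? ? ->]]]] [a2 [b2 [d2 [? ? ? ->]]]].
    by exists (a1 + a2), (b1 + b2), (d1 + d2); split; [apply: idealD..|ring].
  - move=> w _ [a1 [b1 [d1 [? ? ? ->]]]].
    by exists (w * a1), (w * b1), (w * d1); split; [apply: ideal_mull..|ring].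
have [a1 [b1 [d1 [ha1 hb1 hd1 e1']]]] : X x.
  rewrite ex; apply: idealD => //; last by exists 0, z, 0; split=> //; ring.
  rewrite big_seq; apply: ideal_bigsum => // i; rewrite rgE => ri.
  have /ideal_gen1P [v ev] := pic i ri.
  have /decomp [v' [d' [hd' ed']]] :=
    proj_sub (take j.+1 params) (take j.+1 params_dual) (c i).
  exists (v' * (A i * H i)), (v * A i * gen_form ^+ (m.+1 - n)), (A i * H i * d');
    split.
  - by apply: ideal_mull => //; apply: AH_IZ.
  - apply: ideal_mull => //; apply: (@pow2_le _ _ _ _ (m.+1 - n)); first by lia.
    by apply: pow2_exp; exact: gen_form_pow1.
  - exact: ideal_mull.
  have -> : c i = th * v' + d' + v * B i by rewrite -ed' -ev; rewrite /pi; ring.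
  by rewrite -(@cofBM n i) ?rgE //; ring.
have F0 : prodB n != 0.
  rewrite /prodB prodf_seq_neq0; apply/allP => i; rewrite rgE => ri /=.
  have [x0 [y0 e]] := bezout_pair (pq_neq0 ri);
    apply/eqP => /(congr1 (meval (basis_point 0 0 x0 y0 0))).
  rewrite hB // meval_basis meval0 !mul0r !(addr0, add0r) e => /eqP.
  by rewrite oner_eq0.
(* [pi] fixes the nonzero product of the [B_i], which therefore cancels; then [pow2_proj] divides
   [b1] by [th]. *)
have pib1 : pi b1 = 0.
  have : pi (prodB n * b1) = 0.
    apply/pi0/decomp; exists (g - a1), (- (y + d1)); split.
      by apply: idealN => //; apply: idealD.
    have -> : prodB n * b1 = x - th * a1 - d1 by rewrite e1'; ring.
    have -> : x = th * g - y by rewrite exy addrK.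
    by ring.
  have piF : pi (prodB n) = prodB n.
    by rewrite /pi rmorph_prod; apply: eq_big_seq => i; rewrite rgE => ri; apply: piB.
  rewrite /pi rmorphM /= -/pi piF => /eqP; rewrite mulf_eq0 (negPf F0) /=.
  by move/eqP.
have [||||b2 [d2 [hb2 hd2 eb]]] := @pow2_proj _ (B 1%N) (B 2%N) th (take j params)
   (take j.+1 params_dual) (m - n) b1.
- by rewrite -eqr; exact: (piB _ rg1).
- by rewrite -eqr; exact: (piB _ rg2).
- exact: hb1.
- by rewrite -eqr.
have [_ [_ hM]] := dual_prime (dual_take dual_params j).
have : K (th * (g - a1 - prodB n * b2)).
  have -> : th * (g - a1 - prodB n * b2) = y + d1 + prodB n * d2.
    have -> : th * (g - a1 - prodB n * b2) =
      th * g - th * a1 - prodB n * (th * b2) by ring.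
    by rewrite exy e1' eb; ring.
  by apply: idealD => //; [apply: idealD|apply: ideal_mull].
case/hM => [|hg]; first by move/(dual_nth_notin dual_params).
have -> : g = (a1 + prodB n * b2) + (g - a1 - prodB n * b2) by ring.
exists (a1 + prodB n * b2), (g - a1 - prodB n * b2); split=> //.
by apply: idealD => //; apply: prodB_pow_IZ.
Qed.

Lemma regular_params : regular_seq I params.
Proof.
have irr h : ideal_gen params h -> irrel h by exact: (dual_irrel dual_params).
split; [|split].
- by move=> h hp; apply: irr; apply: mem_ideal_gen.
- case=> x [y [[hx _] [/irr hy /(congr1 (meval (fun=> 0)))]]].
  have [x0 [x1 [x2 [x3 hd]]]] := dual_AB rg1.
  have := dual_irrel hd (hx _ rg1); rewrite /irrel in hy * => hx0.
  by rewrite meval1 mevalD hx0 hy addr0 => /eqP; rewrite oner_eq0.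
- by move=> j hj g; apply: params_step.
Qed.

End Regular.
End Interpolation.



(** The element [F B_1^m] of [I_Z] puts some [B_i] into [P]; then [A_i G_i B_j^m] with [j != i] puts
    [A_i] or a second [B_l] into [P]. *)
Lemma prime_over_IZ P : (0 < m)%N -> is_prime P -> (forall x, I x -> P x) ->
  exists f g vs, [/\ dual [:: f; g] vs, P f & P g].
Proof.
move=> m0 hP hI; have [hPI [_ hM]] := hP.
pose F := \prod_(j <- iota 1 n) B j.
pose G i := \prod_(j <- iota 1 n | j != i) B j.
have rgE' i : (i \in iota 1 n) = rg i by rewrite mem_iota add1n ltnS.
have powm i : rg i -> ideal_pow2 (B 1%N) (B 2%N) m (B i ^+ m).
  by move=> ri; apply: pow2_exp; exact: B_pow1.
have dvdP i j : rg i -> rg j -> i != j -> P (B i) -> P (B j) ->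
  exists f g vs, [/\ dual [:: f; g] vs, P f & P g].
  move=> ri rj ij Pi Pj; have D0 := hpq ri rj ij; pose D := p i * q j - p j * q i.
  exists (B i), (B j), [:: basis_point 0 0 (q j / D) (- p j / D) 0;
    basis_point 0 0 (- q i / D) (p i / D) 0].
  split=> //; rewrite (hB ri) (hB rj).
  by apply: dual_seq2; try exact: lform_basis_form; rewrite meval_basis /D; field.
have [i [ri Pi]] : exists i, rg i /\ P (B i).
  have : P (F * B 1%N ^+ m).
    apply: hI; split=> [i ri|]; last by apply: ideal_mull => //; exact: powm rg1.
    have [|//|x e] := @prod_B_dvd (iota 1 n) (fun=> true) i; first by rewrite rgE'.
    by rewrite /F e -mulrA; exact: AB_mulB.
  case/hM => [/(prime_prod hP) [i [hi _ Pi]]|/(prime_exp hP) P1].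
    by exists i; rewrite -rgE'.
  by exists 1%N; split=> //; exact: rg1.
have AG j : rg j -> P (A i * G i * B j ^+ m).
  move=> rj; apply: hI; split=> [l rl|]; last by apply: ideal_mull => //; exact: powm.
  have [<-|il] := eqVneq i l; first by rewrite -mulrA; exact: AB_mulA.
  have [||x e] := @prod_B_dvd (iota 1 n) (fun j => j != i) l; first by rewrite rgE'.
    by rewrite eq_sym.
  by rewrite /G e -mulrA mulrCA -mulrA; exact: AB_mulB.
have fin j : rg j -> i != j -> exists f g vs, [/\ dual [:: f; g] vs, P f & P g].
  move=> rj ij; case: (hM _ _ (AG j rj)) => [/hM [PA|]|/(prime_exp hP) Pj].
  - have [x [y [x' [y' hd]]]] := dual_AB ri.
    by exists (A i), (B i), [:: basis_point x y 0 0 0; basis_point 0 0 x' y' 0].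
  - case/(prime_prod hP) => l [rl li Pl].
    by apply: (dvdP i l) => //; rewrite 1?eq_sym // -rgE'.
  - exact: (dvdP i j).
case: (eqVneq i 1%N) => [i1|]; last exact: fin rg1.
by apply: (fin 2%N rg2); rewrite i1.
Qed.

Lemma cohen_macaulay_IZ : (n.-1 <= m)%N -> cohen_macaulay I.
Proof.
move=> hmn; exists 3%N; split.
  split; first exact: prime_chain3_IZ.
  by apply: no_prime_chain4 => P; apply: prime_over_IZ; lia.
(* [lam] makes [E] proportional to no [B_i]; [mu] keeps every [A_i] nonzero under [s -> E],
   [t -> mu E]. *)
have [lam hlam] : exists lam, forall i, i \in iota 1 n -> q i + lam * - p i != 0.
  apply: avoid_roots => // i; rewrite mem_iota add1n ltnS => ri.
  by rewrite oppr_eq0 orbC pq_neq0.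
have [mu hmu] : exists mu, forall i, i \in iota 1 n -> a i + mu * b i != 0.
  by apply: avoid_roots => // i; rewrite mem_iota add1n ltnS => ri; exact: hab.
exists (params lam mu); split=> //; apply: regular_params => // i ri.
  by have := hlam i; rewrite mem_iota add1n ltnS mulrN; apply.
by have := hmu i; rewrite mem_iota add1n ltnS; apply.
Qed.

End Core.

(** * Choice of coordinates *)

Section Coordinates.
Variable k : fieldType.
Notation R := {mpoly k[5]}.

(** By the vanishing minors, the value of the second form times each coefficient of the first is 0,
    and these coefficients are not all 0. *)
Lemma zero_locus1_sub (f g e : R) x y z x' y' z' v :
  x * y' = x' * y -> x * z' = x' * z -> y * z' = y' * z ->
  x *: f + y *: g + z *: e != 0 ->
  (x *: f + y *: g + z *: e).@[v] = 0 -> (x' *: f + y' *: g + z' *: e).@[v] = 0.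
Proof.
move=> e1 e2 e3 h0; rewrite !mevalD !mevalZ; set F := f.@[v]; set G := g.@[v].
set H := e.@[v] => hv; set w := (X in X = 0).
have xw : x * w = 0.
  transitivity (x' * (x * F + y * G + z * H)); last by rewrite hv mulr0.
  by rewrite /w !mulrDr !mulrA e1 e2 [x * x']mulrC.
have yw : y * w = 0.
  transitivity (y' * (x * F + y * G + z * H)); last by rewrite hv mulr0.
  by rewrite /w !mulrDr !mulrA e3 [y * x']mulrC -e1 [y' * x]mulrC [y' * y]mulrC.
have zw : z * w = 0.
  transitivity (z' * (x * F + y * G + z * H)); last by rewrite hv mulr0.
  by rewrite /w !mulrDr !mulrA [z * x']mulrC -e2 [z * y']mulrC -e3
    [z' * x]mulrC [z' * y]mulrC [z' * z]mulrC.
have [//|w0] := eqVneq w 0; case/eqP: h0.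
move/eqP: xw; move/eqP: yw; move/eqP: zw; rewrite !mulf_eq0 (negPf w0) !orbF.
by move=> /eqP-> /eqP-> /eqP->; rewrite !scale0r !addr0.
Qed.

(** Used in contrapositive form: distinct zero loci give a nonzero minor. Forms in two variables
    take third coefficient 0. *)
Lemma zero_locus1_eq (f g e : R) x y z x' y' z' :
  x * y' = x' * y -> x * z' = x' * z -> y * z' = y' * z ->
  x *: f + y *: g + z *: e != 0 -> x' *: f + y' *: g + z' *: e != 0 ->
  zero_locus [:: x *: f + y *: g + z *: e] =
    zero_locus [:: x' *: f + y' *: g + z' *: e].
Proof.
move=> e1 e2 e3 h0 h0'; apply: functional_extensionality => v.
apply: propositional_extensionality; rewrite /zero_locus.
split=> -[hs [ht hv]]; (split; [exact: hs|split; [exact: ht|move=> h]]);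
  rewrite inE => /eqP->.
  by apply: (zero_locus1_sub e1 e2 e3 h0); apply: hv; rewrite mem_head.
apply: (zero_locus1_sub _ _ _ h0'); first by rewrite e1.
- by rewrite e2.
- by rewrite e3.
by apply: hv; rewrite mem_head.
Qed.

Definition vec5 (v0 v1 v2 v3 v4 : k) : 'I_5 -> k :=
  fun i => nth 0 [:: v0; v1; v2; v3; v4] i.

Lemma vec5E v0 v1 v2 v3 v4 j : (j < 5)%N ->
  vec5 v0 v1 v2 v3 v4 (inord j) = nth 0 [:: v0; v1; v2; v3; v4] j.
Proof. by move=> hj; rewrite /vec5 inordK. Qed.

Lemma meval_var v0 v1 v2 v3 v4 j : (j < 5)%N ->
  (var k j).@[vec5 v0 v1 v2 v3 v4] = nth 0 [:: v0; v1; v2; v3; v4] j.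
Proof. by move=> hj; rewrite /var mevalXU vec5E. Qed.

Lemma meval_var01 v0 v1 v2 v3 v4 :
  ((var k 0).@[vec5 v0 v1 v2 v3 v4] = v0) * ((var k 1).@[vec5 v0 v1 v2 v3 v4] = v1).
Proof. by rewrite !meval_var. Qed.

Lemma meval_var234 u v w v0 v1 v2 v3 v4 :
  (u *: var k 2 + v *: var k 3 + w *: var k 4).@[vec5 v0 v1 v2 v3 v4] =
  u * v2 + v * v3 + w * v4.
Proof. by rewrite !mevalD !mevalZ !meval_var. Qed.

Lemma in_R10_lform (p : R) : in_R10 p -> lform p.
Proof. by case=> a [b ->]; apply: lformD; apply/lformZ/lform_var. Qed.

Lemma in_R01_lform (p : R) : in_R01 p -> lform p.
Proof. by case=> a [b [c ->]]; repeat apply: lformD; apply/lformZ/lform_var. Qed.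

Lemma in_R10_meval (p : R) v2 v3 v4 : in_R10 p -> p.@[vec5 0 0 v2 v3 v4] = 0.
Proof.
by case=> a [b ->]; rewrite mevalD !mevalZ !meval_var //= !mulr0 addr0.
Qed.

Lemma in_R01_meval (p : R) v0 v1 : in_R01 p -> p.@[vec5 v0 v1 0 0 0] = 0.
Proof.
by case=> a [b [c ->]]; rewrite !mevalD !mevalZ !meval_var //= !mulr0 !addr0.
Qed.

Lemma in_R01_meval_proj (p : R) v0 v1 v2 v3 v4 : in_R01 p ->
  p.@[vec5 v0 v1 v2 v3 v4] = p.@[vec5 0 0 v2 v3 v4].
Proof.
by case=> a [b [c ->]]; rewrite !mevalD !mevalZ !meval_var.
Qed.

(* The duals of [B1], [B2], [C] are the cross products of pairs of coefficient
   vectors. *)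
Lemma dual_cross (B1 B2 : R) : in_R01 B1 -> in_R01 B2 -> B1 != 0 -> B2 != 0 ->
  zero_locus [:: B1] <> zero_locus [:: B2] ->
  exists C f1 f2 g2 g3 g4,
    [/\ dual [:: var k 0; var k 1; B1; B2; C]
          [:: vec5 1 0 0 0 0; vec5 0 1 0 0 0; f1; f2; vec5 0 0 g2 g3 g4],
        exists u v w, f1 = vec5 0 0 u v w, exists u v w, f2 = vec5 0 0 u v w
      & [|| g2 != 0, g3 != 0 | g4 != 0]].
Proof.
move=> [x2 [x3 [x4 ->]]] [y2 [y3 [y4 ->]]] n1 n2 hz.
pose g2 := x3 * y4 - x4 * y3; pose g3 := x4 * y2 - x2 * y4;
  pose g4 := x2 * y3 - x3 * y2.
have g0 : [|| g2 != 0, g3 != 0 | g4 != 0].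
  rewrite -!negb_and; apply/negP => /and3P[/eqP h2 /eqP h3 /eqP h4]; apply: hz.
  apply: zero_locus1_eq => //; apply/eqP; rewrite -subr_eq0.
  - by rewrite -[_ == _]/(x2 * y3 - y2 * x3 == 0) [y2 * _]mulrC -/g4 h4.
  - by rewrite -oppr_eq0 opprB [y2 * _]mulrC -/g3 h3.
  - by rewrite [y3 * _]mulrC -/g2 h2.
(* The cross product [g] is the common zero of [B1] and [B2]; [C] is any form with value 1 there. *)
have [c2 [c3 [c4 hc]]] : exists c2 c3 c4, c2 * g2 + c3 * g3 + c4 * g4 = 1.
  case/or3P: g0 => h; [exists g2^-1, 0, 0|exists 0, g3^-1, 0|exists 0, 0, g4^-1];
    by rewrite !mul0r ?addr0 ?add0r mulVf.
exists (c2 *: var k 2 + c3 *: var k 3 + c4 *: var k 4).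
exists (vec5 0 0 (y3 * c4 - y4 * c3) (y4 * c2 - y2 * c4) (y2 * c3 - y3 * c2)).
exists (vec5 0 0 (c3 * x4 - c4 * x3) (c4 * x2 - c2 * x4) (c2 * x3 - c3 * x2)).
exists g2, g3, g4; split; [|by do 3 eexists|by do 3 eexists|exact: g0].
have lv (u v w : k) : lform (u *: var k 2 + v *: var k 3 + w *: var k 4).
  by repeat apply: lformD; apply/lformZ/lform_var.
split.
  by move=> h; rewrite !inE => /or4P[|||/orP[]] /eqP->;
    first [exact: lv|exact: lform_var].
case=> [|[|[|[|[|i]]]]] [|[|[|[|[|j]]]]] hi hj; try discriminate hi;
  try discriminate hj; rewrite /= ?meval_var01 ?meval_var234 -?hc /g2 /g3 /g4; ring.
Qed.
End Coordinates.

Theorem theorem4p15 (k : fieldType) (hchar : [pchar k] =i pred0)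
  (n m : nat) (hn : (2 <= n)%N) (A B : nat -> {mpoly k[5]})
  (hA : forall i, (1 <= i <= n)%N -> in_R10 (A i) /\ A i != 0)
  (hB : forall i, (1 <= i <= n)%N -> in_R01 (B i) /\ B i != 0)
  (h1 : zero_locus [:: A n.-1] <> zero_locus [:: A n])
  (h2 : forall i j, (1 <= i <= n)%N -> (1 <= j <= n)%N -> i != j ->
          zero_locus [:: B i] <> zero_locus [:: B j])
  (h3 : zero_locus [seq B i | i <- iota 1 n] = zero_locus [:: B 1%N; B 2%N]) :
  cohen_macaulay (IZ n m A B) <-> (n.-1 <= m)%N.
Proof.
have r1 : (1 <= 1 <= n)%N by rewrite /= ltnW.
have r2 : (1 <= 2 <= n)%N by [].
have [B1 B10] := hB _ r1; have [B2 B20] := hB _ r2.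
have [C [f1 [f2 [g2 [g3 [g4 [hd [u1 [v1 [w1 ef1]]] [u2 [v2 [w2 ef2]]] g0]]]]]]] :=
  dual_cross B1 B2 B10 B20 (h2 _ _ r1 r2 isT).
set e0 := vec5 1 0 0 0 0 in hd; set e1 := vec5 0 1 0 0 0 in hd.
set c0 := vec5 0 0 g2 g3 g4 in hd.
have expand := dual_full_expand (erefl _ : size [:: _; _; _; _; _] = 5%N) hd.
have EA i : (1 <= i <= n)%N ->
  A i = basis_form B (var k 0) (var k 1) C (A i).@[e0] (A i).@[e1] 0 0 0.
  move=> ri; have [Ai _] := hA i ri.
  rewrite {1}(expand _ (in_R10_lform Ai)) !big_ord_recl big_ord0 /= /basis_form ef1 ef2.
  by rewrite !(in_R10_meval _ _ _ Ai) !scale0r !addr0.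
have EB i : (1 <= i <= n)%N ->
  B i = basis_form B (var k 0) (var k 1) C 0 0 (B i).@[f1] (B i).@[f2] 0.
  move=> ri; have [Bi _] := hB i ri.
  rewrite {1}(expand _ (in_R01_lform Bi)) !big_ord_recl big_ord0 /= /basis_form.
  rewrite !(in_R01_meval _ _ Bi) !scale0r !add0r.
  (* The coefficient of [C] vanishes because [c0] is a common zero of [B_1] and [B_2], hence of all
     [B_i] by [h3]. The first coordinate is changed to 1 since points of [zero_locus] need both
     factors nonzero. *)
  suff -> : (B i).@[c0] = 0 by rewrite !scale0r !addr0.
  rewrite /c0 -(in_R01_meval_proj 1 0 _ _ _ Bi).
  have : zero_locus [:: B 1%N; B 2%N] (vec5 1 0 g2 g3 g4).
    rewrite /zero_locus (vec5E _ _ _ _ _ (isT : 0 < 5)%N).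
    rewrite (vec5E _ _ _ _ _ (isT : 1 < 5)%N).
    rewrite (vec5E _ _ _ _ _ (isT : 2 < 5)%N) (vec5E _ _ _ _ _ (isT : 3 < 5)%N).
    rewrite (vec5E _ _ _ _ _ (isT : 4 < 5)%N) /=.
    split; first by left; exact: oner_neq0.
    split; first by case/or3P: g0 => h; [left|right; left|right; right].
    have T l := hd.2 4%N l isT.
    move=> p; rewrite !inE => /orP[]/eqP->.
      by rewrite (in_R01_meval_proj _ _ _ _ _ B1); exact: (T 2%N isT).
    by rewrite (in_R01_meval_proj _ _ _ _ _ B2); exact: (T 3%N isT).
  rewrite -h3 => -[_ [_]]; apply; apply: map_f.
  by rewrite mem_iota add1n ltnS.
have hab i : (1 <= i <= n)%N -> ((A i).@[e0] != 0) || ((A i).@[e1] != 0).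
  move=> ri; have [_ Ai0] := hA i ri; apply: contraNT Ai0.
  rewrite negb_or !negbK => /andP[/eqP E0 /eqP E1]; rewrite (EA i ri) E0 E1 /basis_form.
  by rewrite !scale0r !addr0.
have hpq i j : (1 <= i <= n)%N -> (1 <= j <= n)%N -> i != j ->
    (B i).@[f1] * (B j).@[f2] - (B j).@[f1] * (B i).@[f2] != 0.
  move=> ri rj ij; apply/eqP => /subr0_eq e; apply: (h2 i j ri rj ij).
  have [_ Bi0] := hB i ri; have [_ Bj0] := hB j rj.
  have EBl l : (1 <= l <= n)%N ->
      B l = (B l).@[f1] *: B 1%N + (B l).@[f2] *: B 2%N + 0 *: C.
    by move=> rl; rewrite {1}(EB _ rl) /basis_form !scale0r !add0r.
  rewrite (EBl _ ri) in Bi0 *; rewrite (EBl _ rj) in Bj0 *.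
  by apply: zero_locus1_eq; rewrite ?mulr0 ?mul0r.
have hAA : (A n.-1).@[e0] * (A n).@[e1] - (A n).@[e0] * (A n.-1).@[e1] != 0.
  apply/eqP => /subr0_eq e; apply: h1.
  have rn : (1 <= n <= n)%N by rewrite leqnn andbT ltnW.
  have rn1 : (1 <= n.-1 <= n)%N by lia.
  have [_ An0] := hA _ rn; have [_ An10] := hA _ rn1.
  have EAl l : (1 <= l <= n)%N ->
      A l = (A l).@[e0] *: var k 0 + (A l).@[e1] *: var k 1 + 0 *: C.
    by move=> rl; rewrite {1}(EA _ rl) /basis_form !scale0r !addr0.
  rewrite (EAl _ rn) in An0 *; rewrite (EAl _ rn1) in An10 *.
  by apply: zero_locus1_eq; rewrite ?mulr0 ?mul0r.
split=> [hCM|].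
  rewrite leqNgt; apply/negP => lt.
  exact: (not_cohen_macaulay_IZ hchar hd hn EA EB hab hpq hAA lt hCM).
exact: (cohen_macaulay_IZ hchar hd hn EA EB hab hpq hAA).
Qed.
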